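(* Assume (A1)–(A4). Let $K$ be a fixed positive integer, run SLPMM with $\alpha=\sqrt K$ and $\sigma=1/\sqrt K$, and let $\bar x^K:=\frac1K\sum_{k=0}^{K-1}x^k$. Then: (i) if $K>\max\{1,p\kappa_g^2/2\}$, then for each $i=1,\dots,p$, $$\mathbb E[g_i(\bar x^K)]\le\frac{(1+\sqrt p\,\kappa_g^2)\bar\kappa+\kappa_g\kappa_f}{\sqrt K}+\frac{(1+\sqrt p\,\kappa_g^2)\kappa_2+\sqrt p\,\nu_g\kappa_g^2}{K};$$ (ii) for all $K\ge1$ and any optimal solution $x^*$ of the problem $\min\{f(x): x\in\Phi\}$, $$\mathbb E[f(\bar x^K)]-f(x^* )\le\frac{\kappa_f^2+\nu_g^2+R^2}{2\sqrt K}.$$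
   Context: Let $\mathcal C\subset\mathbb R^n$ be a nonempty compact convex set. Let $\xi$ be a random vector whose distribution is supported on $\Xi\subseteq\mathbb R^q$, and let $F:\mathcal C\times\Xi\to\mathbb R$ and $G_i:\mathcal C\times\Xi\to\mathbb R$ ($i=1,\dots,p$) be such that $F(\cdot,\xi)$, $G_i(\cdot,\xi)$ are convex and continuous on $\mathcal C$ for every $\xi$, and $f(x):=\mathbb E[F(x,\xi)]$, $g_i(x):=\mathbb E[G_i(x,\xi)]$ are finite on $\mathcal C$. Write $G=(G_1,\dots,G_p)^T$. The feasible set is $\Phi:=\{x\in\mathcal C: g_i(x)\le0,\ i=1,\dots,p\}$. Stochastic subgradients: $v_0(x,\xi)\in\partial_xF(x,\xi)$, $v_i(x,\xi)\in\partial_xG_i(x,\xi)$. $[t]_+=\max\{t,0\}$, $[t]_+^2=(\max\{t,0\})^2$. SLPMM: fix $\sigma,\alpha>0$, $x^0\in\mathcal C$, $\lambda^0=0\in\mathbb R^p$, i.i.d. copies $\xi^0,\xi^1,\dots$ of $\xi$. For $k\ge0$, $x^{k+1}=\arg\min_{x\in\mathcal C}\{\mathcal L^k_\sigma(x,\lambda^k)+\frac{\alpha}{2}\|x-x^k\|^2\}$ with $\mathcal L^k_\sigma(x,\lambda):=F(x^k,\xi^k)+\langle v_0(x^k,\xi^k),x-x^k\rangle+\frac{1}{2\sigma}[\sum_{i=1}^p[\lambda_i+\sigma(G_i(x^k,\xi^k)+\langle v_i(x^k,\xi^k),x-x^k\rangle)]_+^2-\|\lambda\|^2]$, and $\lambda_i^{k+1}=[\lambda_i^k+\sigma(G_i(x^k,\xi^k)+\langle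 v_i(x^k,\xi^k),x^{k+1}-x^k\rangle)]_+$. Assumptions: (A1) $\|x'-x''\|\le R$ on $\mathcal C$. (A2) $\|G(x,\xi)\|\le\nu_g$ for all $x\in\mathcal C,\xi\in\Xi$. (A3) $\|v_0(x,\xi)\|\le\kappa_f$, $\|v_i(x,\xi)\|\le\kappa_g$ for all $x,\xi$. (A4) (Slater) there exist $\varepsilon_0>0$ and $\hat x\in\mathcal C$ with $g_i(\hat x)\le-\varepsilon_0$ for all $i$. Constants: $\beta_0:=\nu_g+\sqrt p\,\kappa_gR$, $\kappa_0:=\frac{2\kappa_fR}{\varepsilon_0}$, $\kappa_1:=\frac{R^2}{\varepsilon_0}$, $\kappa_2:=\frac{\nu_g^2}{\varepsilon_0}-\beta_0$, $\kappa_3:=2\beta_0+\frac{\varepsilon_0}{2}+\frac{8\beta_0^2}{\varepsilon_0}\log\frac{32\beta_0^2}{\varepsilon_0^2}$, and $\bar\kappa:=\kappa_0+\kappa_1+2\kappa_3$. *)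

(* Defs.v *)
From HB Require Import structures.
From mathcomp Require Import all_boot all_order all_algebra.
From mathcomp Require Import all_classical all_reals all_analysis.
Set Implicit Arguments. Unset Strict Implicit. Unset Printing Implicit Defensive.
Import Order.TTheory GRing.Theory Num.Theory.
Import numFieldNormedType.Exports.
Local Open Scope classical_set_scope.
Local Open Scope ring_scope.

Section Defs.
Context {R : realType}.

Definition dot {m : nat} (u w : 'rV[R]_m) : R := \sum_(j < m) u 0 j * w 0 j.
Definition enorm {m : nat} (u : 'rV[R]_m) : R := Num.sqrt (dot u u).

Definition pos (t : R) : R := Num.max t 0.

Definition convex_on {m : nat} (C : set 'rV[R]_m) (h : 'rV[R]_m -> R) : Prop :=
  forall x y (t : R), C x -> C y -> 0 <= t <= 1 ->
    h (t *: x + (1 - t) *: y) <= t * h x + (1 - t) * h y.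

Definition is_subgrad {m : nat} (C : set 'rV[R]_m) (h : 'rV[R]_m -> R)
  (x w : 'rV[R]_m) : Prop :=
  forall y, C y -> h x + dot w (y - x) <= h y.

(* joint measurability of h : C x Xi -> R (superposition form): composing h
   with any measurable C-valued map and any measurable Xi-valued map on any
   measurable space gives a measurable function. *)
Definition jmeasurable {n : nat} {d} {Xi : measurableType d}
  (C : set 'rV[R]_n) (h : 'rV[R]_n -> Xi -> R) : Prop :=
  forall (d' : measure_display) (T : measurableType d')
         (X : T -> 'rV[R]_n) (Z : T -> Xi),
    (forall t, C (X t)) ->
    (forall j, measurable_fun setT (fun t => X t 0 j)) ->
    measurable_fun setT Z ->
    measurable_fun setT (fun t => h (X t) (Z t)).

Definition expect {n : nat} {d} {Xi : measurableType d}
  (mu : probability Xi R) (H : 'rV[R]_n -> Xi -> R) (x : 'rV[R]_n) : R :=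
  fine (\int[mu]_z (H x z)%:E)%E.

(* the linearized augmented Lagrangian L^k_sigma(x, lambda), at the sample z = xi^k
   and the current iterate xk = x^k *)
Definition Lsig {n p : nat} {d} {Xi : measurableType d} (sigma : R)
  (F : 'rV[R]_n -> Xi -> R) (G : 'rV[R]_n -> Xi -> 'rV[R]_p)
  (v0 : 'rV[R]_n -> Xi -> 'rV[R]_n) (v : 'I_p -> 'rV[R]_n -> Xi -> 'rV[R]_n)
  (xk : 'rV[R]_n) (z : Xi) (x : 'rV[R]_n) (lam : 'rV[R]_p) : R :=
  F xk z + dot (v0 xk z) (x - xk)
  + (2 * sigma)^-1 *
    (\sum_(i < p) (pos (lam 0 i + sigma * (G xk z 0 i + dot (v i xk z) (x - xk)))) ^+ 2
     - enorm lam ^+ 2).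

Definition slpmm_traj {n p : nat} {d} {Xi : measurableType d} {dO}
  {Omega : measurableType dO} (sigma alpha : R) (C : set 'rV[R]_n)
  (F : 'rV[R]_n -> Xi -> R) (G : 'rV[R]_n -> Xi -> 'rV[R]_p)
  (v0 : 'rV[R]_n -> Xi -> 'rV[R]_n) (v : 'I_p -> 'rV[R]_n -> Xi -> 'rV[R]_n)
  (x0 : 'rV[R]_n) (xi : nat -> Omega -> Xi)
  (xs : nat -> Omega -> 'rV[R]_n) (lams : nat -> Omega -> 'rV[R]_p) : Prop :=
  (forall w, xs 0%N w = x0) /\ (forall w, lams 0%N w = 0) /\
  (forall k w,
     C (xs k.+1 w) /\
     (forall y, C y ->
        Lsig sigma F G v0 v (xs k w) (xi k w) (xs k.+1 w) (lams k w)
          + alpha / 2 * enorm (xs k.+1 w - xs k w) ^+ 2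
        <= Lsig sigma F G v0 v (xs k w) (xi k w) y (lams k w)
          + alpha / 2 * enorm (y - xs k w) ^+ 2)) /\
  (forall k w (i : 'I_p),
     lams k.+1 w 0 i =
       pos (lams k w 0 i + sigma * (G (xs k w) (xi k w) 0 i
              + dot (v i (xs k w) (xi k w)) (xs k.+1 w - xs k w)))).

Definition iid_with_law {d} {Xi : measurableType d} {dO} {Omega : measurableType dO}
  (P : probability Omega R) (mu : probability Xi R) (xi : nat -> Omega -> Xi) : Prop :=
  (forall k, measurable_fun setT (xi k)) /\
  (forall k A, measurable A -> P (xi k @^-1` A) = mu A) /\
  (forall (s : seq nat) (A : nat -> set Xi), uniq s ->
     (forall k, measurable (A k)) ->
     P (\big[setI/setT]_(k <- s) (xi k @^-1` A k)) =
       (\prod_(k <- s) P (xi k @^-1` A k))%E).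

Definition xbar {n : nat} {dO} {Omega : measurableType dO}
  (xs : nat -> Omega -> 'rV[R]_n) (K : nat) (w : Omega) : 'rV[R]_n :=
  (K%:R)^-1 *: \sum_(k < K) xs k w.

Definition beta0 (p : nat) (nu_g kappa_g Rd : R) : R :=
  nu_g + Num.sqrt (p%:R) * kappa_g * Rd.
Definition kappa0 (kappa_f Rd eps0 : R) : R := 2 * kappa_f * Rd / eps0.
Definition kappa1 (Rd eps0 : R) : R := Rd ^+ 2 / eps0.
Definition kappa2 (p : nat) (nu_g kappa_g Rd eps0 : R) : R :=
  nu_g ^+ 2 / eps0 - beta0 p nu_g kappa_g Rd.
Definition kappa3 (p : nat) (nu_g kappa_g Rd eps0 : R) : R :=
  let b := beta0 p nu_g kappa_g Rd in
  2 * b + eps0 / 2 + 8 * b ^+ 2 / eps0 * ln (32 * b ^+ 2 / eps0 ^+ 2).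
Definition kappabar (p : nat) (kappa_f nu_g kappa_g Rd eps0 : R) : R :=
  kappa0 kappa_f Rd eps0 + kappa1 Rd eps0 + 2 * kappa3 p nu_g kappa_g Rd eps0.

End Defs.

(* Main.v *)
(** Minimizing the proximal augmented Lagrangian gives, for every y in C, a
    three-point inequality bounding F(x^k) - F(y) by <lambda^k, G(y)> plus terms
    that telescope. For y = x* the multiplier term has nonpositive mean, because
    lambda^k depends only on xi^0, ..., xi^(k-1); summing yields (ii). The multiplier
    update bounds the sum of the G_i(x^k) by the multipliers, so (i) reduces to a
    uniform bound on E|lambda^k|. By the Slater point, over a window of about
    sqrt K steps |lambda^k| drifts downwards whenever it exceeds a threshold, and has
    bounded increments; the exponential Lyapunov function exp(r |lambda^k|) then has
    bounded mean, and Jensen's inequality gives the logarithm in kappa_3.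
    Conditional expectations are avoided: the drift is a pointwise inequality whose
    error term is a past-measurable weight times centered fresh samples.
    The iterates are measurable because the argmin of a strongly convex function is
    determined by its values on a countable dense subset of C. *)
Require Import Defs.
From HB Require Import structures.
From mathcomp Require Import all_boot all_order all_algebra.
From mathcomp Require Import all_classical all_reals all_analysis.
From mathcomp Require Import measurable_realfun ring lra.
Import Order.TTheory GRing.Theory Num.Theory.
Import numFieldNormedType.Exports.
Set Implicit Arguments. Unset Strict Implicit. Unset Printing Implicit Defensive.
Local Open Scope classical_set_scope.
Local Open Scope ring_scope.

(** A single step need not lower [|lambda^k|]: its proximal term [alpha / 2 * (a k - a k.+1)] may be
    of order [sqrt K] and is controlled only by telescoping. Over [t0 >= alpha] steps it costs at
    most [Rd ^+ 2 / 2] per step, the origin of [kappa1]. Choosing [t0] just above [sqrt K] keeps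
    [tau = sigma * t0] between 1 and 2, so all bounds become uniform in [K]. The window estimate
    concerns squared norms. It is turned into an estimate of the norm that is linear in the noise,
    with a coefficient known when the window starts; this is what makes the noise vanish in mean,
    even after multiplication by the exponential. In [kappa3], [b + eps0 / 2] comes from the
    threshold [theta], a second [b] from the growth over one window, and the logarithm from
    [ln (1 / (1 - rho)) / rate], each up to the factor [tau]. *)

Section Euclidean.
Context {R : realType}.

Lemma dotC m (u w : 'rV[R]_m) : dot u w = dot w u.
Proof. by apply: eq_bigr => j _; rewrite mulrC. Qed.

Lemma dotDl m (u w z : 'rV[R]_m) : dot (u + w) z = dot u z + dot w z.
Proof. by rewrite /dot -big_split; apply: eq_bigr => j _; rewrite mxE mulrDl. Qed.

Lemma dotZl m a (u z : 'rV[R]_m) : dot (a *: u) z = a * dot u z.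
Proof. by rewrite /dot mulr_sumr; apply: eq_bigr => j _; rewrite mxE mulrA. Qed.

Lemma dotNl m (u z : 'rV[R]_m) : dot (- u) z = - dot u z.
Proof. by rewrite -scaleN1r dotZl mulN1r. Qed.

Lemma dotDr m (u w z : 'rV[R]_m) : dot z (u + w) = dot z u + dot z w.
Proof. by rewrite dotC dotDl !(dotC z). Qed.

Lemma dotNr m (u z : 'rV[R]_m) : dot z (- u) = - dot z u.
Proof. by rewrite dotC dotNl dotC. Qed.

Lemma dotZr m a (u z : 'rV[R]_m) : dot z (a *: u) = a * dot z u.
Proof. by rewrite dotC dotZl dotC. Qed.

Lemma dot_ge0 m (u : 'rV[R]_m) : 0 <= dot u u.
Proof. by apply: sumr_ge0 => j _; rewrite -expr2 sqr_ge0. Qed.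

Lemma enorm_ge0 m (u : 'rV[R]_m) : 0 <= enorm u.
Proof. exact: sqrtr_ge0. Qed.

Lemma sqr_enorm m (u : 'rV[R]_m) : enorm u ^+ 2 = dot u u.
Proof. by rewrite sqr_sqrtr ?dot_ge0. Qed.

Lemma sqr_enormE m (u : 'rV[R]_m) : enorm u ^+ 2 = \sum_(j < m) u 0 j ^+ 2.
Proof. by rewrite sqr_enorm; apply: eq_bigr => j _; rewrite expr2. Qed.

Lemma enormN m (u : 'rV[R]_m) : enorm (- u) = enorm u.
Proof. by rewrite /enorm dotNl dotNr opprK. Qed.

Lemma enormZ m a (u : 'rV[R]_m) : enorm (a *: u) = `|a| * enorm u.
Proof.
by rewrite /enorm dotZl dotZr mulrA -expr2 sqrtrM ?sqr_ge0// sqrtr_sqr.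
Qed.

Lemma enorm0_eq0 m (u : 'rV[R]_m) : enorm u = 0 -> u = 0.
Proof.
move=> u0; have /eqP : \sum_(j < m) u 0 j ^+ 2 = 0 by rewrite -sqr_enormE u0 expr0n.
rewrite psumr_eq0 => [/allP h|j _]; last exact: sqr_ge0.
apply/rowP => j; rewrite mxE.
by have := h j; rewrite mem_index_enum sqrf_eq0 => /(_ isT)/eqP.
Qed.

(** Cauchy-Schwarz: the squared norm of [|w| u - |u| w] equals [2 |u| |w| (|u| |w| - dot u w)], and
    the positive factor cancels. *)
Lemma dot_le_enorm m (u w : 'rV[R]_m) : dot u w <= enorm u * enorm w.
Proof.
have [/eqP|ab0] := eqVneq (enorm u * enorm w) 0.
  rewrite mulf_eq0 => /orP[] /eqP /enorm0_eq0 ->.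
    by rewrite -(scale0r (0 : 'rV_m)) dotZl mul0r mulr_ge0// enorm_ge0.
  by rewrite -(scale0r (0 : 'rV_m)) dotZr mul0r mulr_ge0// enorm_ge0.
have ab : 0 < enorm u * enorm w by rewrite lt_def ab0 mulr_ge0// enorm_ge0.
have := dot_ge0 (enorm w *: u - enorm u *: w).
rewrite !(dotDl, dotDr, dotNl, dotNr, dotZl, dotZr) -!sqr_enorm (dotC w u) => h.
rewrite -(ler_pM2l ab) -subr_ge0 -(pmulr_rge0 _ (ltr0n _ 2)).
move: h; congr (0 <= _); ring.
Qed.

Lemma normr_dot_le m (u w : 'rV[R]_m) : `|dot u w| <= enorm u * enorm w.
Proof.
by rewrite ler_norml dot_le_enorm andbT lerNl -dotNl -(enormN u) dot_le_enorm.
Qed.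

Lemma enormD m (u w : 'rV[R]_m) : enorm (u + w) <= enorm u + enorm w.
Proof.
rewrite -(@ler_pXn2r _ 2) ?nnegrE ?addr_ge0 ?enorm_ge0//.
rewrite sqr_enorm !(dotDl, dotDr) -!sqr_enorm (dotC w u).
have := dot_le_enorm u w; nra.
Qed.

Lemma enormB_le m (u w : 'rV[R]_m) : `|enorm u - enorm w| <= enorm (u - w).
Proof.
rewrite ler_norml; apply/andP; split.
  have := enormD u (w - u); rewrite addrC subrK -(enormN (w - u)) opprB; lra.
have := enormD (u - w) w; rewrite subrK; lra.
Qed.

Lemma le_enorm m (u w : 'rV[R]_m) :
  (forall j, `|u 0 j| <= `|w 0 j|) -> enorm u <= enorm w.
Proof.
move=> uw; rewrite -(@ler_pXn2r _ 2) ?nnegrE ?enorm_ge0// !sqr_enormE.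
apply: ler_sum => j _; rewrite -(real_normK (num_real (u 0 j))).
by rewrite -(real_normK (num_real (w 0 j))) ler_pXn2r ?nnegrE.
Qed.

Lemma normr_coord_le m (u : 'rV[R]_m) j : `|u 0 j| <= enorm u.
Proof.
rewrite -(@ler_pXn2r _ 2) ?nnegrE ?enorm_ge0// sqr_enormE real_normK ?num_real//.
by rewrite (bigD1 j)//= lerDl sumr_ge0// => i _; exact: sqr_ge0.
Qed.

Lemma enorm_le_sum m (u : 'rV[R]_m) :
  (forall j, 0 <= u 0 j) -> enorm u <= \sum_(j < m) u 0 j.
Proof.
move=> u0; rewrite -(@ler_pXn2r _ 2) ?nnegrE ?enorm_ge0 ?sumr_ge0//.
rewrite sqr_enormE [leRHS]expr2 mulr_sumr; apply: ler_sum => j _.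
by rewrite expr2 ler_wpM2r// (bigD1 j)//= lerDl sumr_ge0.
Qed.

Lemma sum_le_enorm m (u : 'rV[R]_m) :
  \sum_(j < m) u 0 j <= Num.sqrt m%:R * enorm u.
Proof.
have := dot_le_enorm (const_mx 1) u.
rewrite (_ : enorm (const_mx 1 : 'rV_m) = Num.sqrt m%:R); last first.
  rewrite /enorm /dot; congr Num.sqrt; under eq_bigr do rewrite mxE mulr1.
  by rewrite sumr_const card_ord.
apply: le_trans; rewrite le_eqVlt; apply/orP; left.
by apply/eqP; apply: eq_bigr => j _; rewrite mxE mul1r.
Qed.

Lemma enorm_le_const m (u : 'rV[R]_m) a : 0 <= a ->
  (forall j, `|u 0 j| <= a) -> enorm u <= Num.sqrt m%:R * a.
Proof.
move=> a0 ua; have : enorm u <= enorm (const_mx a : 'rV_m).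
  by apply: le_enorm => j; rewrite mxE (ger0_norm a0).
move=> /le_trans; apply.
rewrite -(@ler_pXn2r _ 2) ?nnegrE ?enorm_ge0 ?mulr_ge0 ?sqrtr_ge0//.
rewrite sqr_enormE exprMn sqr_sqrtr ?ler0n//.
under eq_bigr do rewrite mxE.
by rewrite sumr_const card_ord mulr_natl.
Qed.

(** * The positive part and its square *)

Lemma pos_ge0 (t : R) : 0 <= pos t.
Proof. by rewrite /pos le_max lexx orbT. Qed.

Lemma le_pos (t : R) : t <= pos t.
Proof. by rewrite /pos le_max lexx. Qed.

Lemma pos_le_norm (t : R) : pos t <= `|t|.
Proof. by rewrite /pos ge_max ler_norm normr_ge0. Qed.

Lemma ler_pos (s t : R) : s <= t -> pos s <= pos t.
Proof. by move=> st; rewrite /pos ge_max !le_max st lexx orbT. Qed.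

Lemma ler_pos_sqr (s t : R) : s <= t -> pos s ^+ 2 <= pos t ^+ 2.
Proof. by move=> st; rewrite ler_pXn2r ?nnegrE ?pos_ge0 ?ler_pos. Qed.

Lemma pos_sqr_le (t : R) : pos t ^+ 2 <= t ^+ 2.
Proof.
by rewrite -(real_normK (num_real t)) ler_pXn2r ?nnegrE ?pos_ge0 ?pos_le_norm.
Qed.

Lemma pos_dist_le (s t : R) : 0 <= s -> `|pos t - s| <= `|t - s|.
Proof.
move=> s0; rewrite /pos; case: (leP t 0) => // t0.
rewrite sub0r normrN (ger0_norm s0) ler0_norm; lra.
Qed.

Lemma pos_sqr_convex (a b t : R) : 0 <= t <= 1 ->
  pos (t * a + (1 - t) * b) ^+ 2 <= t * pos a ^+ 2 + (1 - t) * pos b ^+ 2.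
Proof.
move=> /andP[t0 t1]; have u0 : 0 <= 1 - t by lra.
have h : pos (t * a + (1 - t) * b) <= t * pos a + (1 - t) * pos b.
  rewrite {1}/pos ge_max; apply/andP; split.
    by rewrite lerD// ler_wpM2l// le_pos.
  by rewrite addr_ge0// mulr_ge0// pos_ge0.
apply: (@le_trans _ _ ((t * pos a + (1 - t) * pos b) ^+ 2)).
  by rewrite ler_pXn2r ?nnegrE ?pos_ge0// addr_ge0// mulr_ge0// pos_ge0.
rewrite -subr_ge0.
rewrite [X in 0 <= X](_ : _ = t * (1 - t) * (pos a - pos b) ^+ 2); last by ring.
by rewrite mulr_ge0 ?sqr_ge0// mulr_ge0.
Qed.

(** Tangent inequality of the convex function [pos t ^+ 2], whose derivative is [2 * pos t]. *)
Lemma pos_sqr_tangent (a b : R) :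
  pos a ^+ 2 - pos b ^+ 2 <= 2 * pos a * (a - b).
Proof.
have := le_pos b; have := pos_ge0 b; have := le_pos a; have := pos_ge0 a.
have [a0|a0] : pos a = 0 \/ pos a = a.
- by rewrite /pos; case: (leP a 0); [left|right].
- by rewrite a0; nra.
- rewrite a0 => ha _ hb bb.
  have := sqr_ge0 (a - pos b); have := ler_wpM2l ha bb; nra.
Qed.

Lemma ler_shrink_limit (a b c : R) : 0 <= c ->
  (forall t, 0 < t <= 1 -> a <= b - (1 - t) * c) -> a <= b - c.
Proof.
move=> c0 h; rewrite leNgt; apply/negP => bac.
have c1 : 0 < 1 + c by lra.
(* The hypothesis bounds the gap [a - (b - c)] by [t * c]; this [t] makes [t * c] smaller than the
   gap. *)
pose t := Num.min 1 ((a - (b - c)) / (2 * (1 + c))).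
have tp : 0 < t by rewrite lt_min ltr01/= divr_gt0 ?mulr_gt0//; lra.
have t1 : t <= 1 by rewrite ge_min lexx.
have := h t; rewrite tp t1 => /(_ isT).
have : t * (2 * (1 + c)) <= a - (b - c).
  by rewrite -ler_pdivlMr ?mulr_gt0// ge_min lexx orbT.
nra.
Qed.

End Euclidean.

(** * One step of the method *)

Section LinearizedStep.
Context {R : realType} {n p : nat} {d : measure_display} {Xi : measurableType d}.
Context (C : set 'rV[R]_n).
Context (F : 'rV[R]_n -> Xi -> R) (G : 'rV[R]_n -> Xi -> 'rV[R]_p).
Context (v0 : 'rV[R]_n -> Xi -> 'rV[R]_n) (v : 'I_p -> 'rV[R]_n -> Xi -> 'rV[R]_n).
Context (sigma alpha Rd nu_g kappa_f kappa_g : R).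
Hypothesis convC : forall x y (t : R), C x -> C y -> 0 <= t <= 1 ->
  C (t *: x + (1 - t) *: y).
Hypothesis subF : forall x z, C x -> is_subgrad C (fun y => F y z) x (v0 x z).
Hypothesis subG : forall (i : 'I_p) x z, C x ->
  is_subgrad C (fun y => G y z 0 i) x (v i x z).
Hypothesis diamC : forall x y, C x -> C y -> enorm (x - y) <= Rd.
Hypothesis boundG : forall x z, C x -> enorm (G x z) <= nu_g.
Hypothesis boundv0 : forall x z, C x -> enorm (v0 x z) <= kappa_f.
Hypothesis boundv : forall (i : 'I_p) x z, C x -> enorm (v i x z) <= kappa_g.
Hypothesis sigma_gt0 : 0 < sigma.
Hypothesis alpha_gt0 : 0 < alpha.

Context (x x' : 'rV[R]_n) (z : Xi) (lam lam' : 'rV[R]_p).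
Hypothesis Cx : C x.
Hypothesis Cx' : C x'.
Hypothesis lam_ge0 : forall i, 0 <= lam 0 i.
Hypothesis min_x' : forall y, C y ->
  Lsig sigma F G v0 v x z x' lam + alpha / 2 * enorm (x' - x) ^+ 2
  <= Lsig sigma F G v0 v x z y lam + alpha / 2 * enorm (y - x) ^+ 2.
Hypothesis lam'E : forall i, lam' 0 i =
  pos (lam 0 i + sigma * (G x z 0 i + dot (v i x z) (x' - x))).

Let L y := Lsig sigma F G v0 v x z y lam.

(** Up to affine terms, [L] is a nonnegative multiple of a sum of squared positive parts of affine
    functions. *)
Lemma Lsig_convex (y w : 'rV[R]_n) (t : R) : 0 <= t <= 1 ->
  L (t *: y + (1 - t) *: w) <= t * L y + (1 - t) * L w.
Proof.
move=> t01; rewrite /L /Lsig.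
have E : t *: y + (1 - t) *: w - x = t *: (y - x) + (1 - t) *: (w - x).
  by rewrite !scalerBr addrACA -opprD -scalerDl [t + _]addrC subrK scale1r.
rewrite !E (dotDr (t *: _)) !dotZr.
have s2 : 0 <= (2 * sigma)^-1 by rewrite invr_ge0 mulr_ge0// ltW.
set Y := fun i => lam 0 i + sigma * (G x z 0 i + dot (v i x z) (y - x)).
set W := fun i => lam 0 i + sigma * (G x z 0 i + dot (v i x z) (w - x)).
have h : \sum_(i < p) pos (lam 0 i + sigma * (G x z 0 i
      + dot (v i x z) (t *: (y - x) + (1 - t) *: (w - x)))) ^+ 2
    <= t * (\sum_(i < p) pos (Y i) ^+ 2) + (1 - t) * (\sum_(i < p) pos (W i) ^+ 2).
  rewrite !mulr_sumr -big_split; apply: ler_sum => i _.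
  apply: le_trans (pos_sqr_convex _ _ t01); rewrite le_eqVlt; apply/orP; left.
  by apply/eqP; congr (pos _ ^+ 2); rewrite (dotDr (t *: _)) !dotZr /Y /W; ring.
have := ler_wpM2l s2 h; rewrite -/(Y _) -/(W _).
set A := \sum_(i < p) pos (Y i) ^+ 2.
set B := \sum_(i < p) pos (W i) ^+ 2.
lra.
Qed.

(* A minimizer of a convex function plus [alpha / 2 * |y - x| ^ 2] beats every
   competitor by the strong convexity margin [alpha / 2 * |y - x'| ^ 2]. *)
Lemma prox_three_point y : C y ->
  L x' + alpha / 2 * enorm (x' - x) ^+ 2 + alpha / 2 * enorm (y - x') ^+ 2
  <= L y + alpha / 2 * enorm (y - x) ^+ 2.
Proof.
move=> Cy; rewrite -lerBrDr; apply: ler_shrink_limit => [|t /andP[t0 t1]].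
  by rewrite mulr_ge0 ?sqr_ge0// divr_ge0// ltW.
have t01 : 0 <= t <= 1 by rewrite (ltW t0).
(* Test minimality on the segment from [x'] to [y]. The quadratic has convexity defect
   [t * (1 - t) * |y - x'|^2], so division by [t] leaves the factor [1 - t] that [ler_shrink_limit]
   removes. *)
have := min_x' (convC Cy Cx' t01).
have := Lsig_convex y x' t01; rewrite -/(L _) -/(L _).
have -> : enorm (t *: y + (1 - t) *: x' - x) ^+ 2 =
    t * enorm (y - x) ^+ 2 + (1 - t) * enorm (x' - x) ^+ 2
    - t * (1 - t) * enorm (y - x') ^+ 2.
  rewrite !sqr_enorm !(dotDl, dotDr, dotNl, dotNr, dotZl, dotZr).
  by rewrite (dotC x' y) (dotC x y) (dotC x x'); ring.
move=> h1 h2.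
rewrite -(ler_pM2l t0).
set e1 := enorm (y - x) ^+ 2 in h2 *.
set e2 := enorm (x' - x) ^+ 2 in h2 *.
set e3 := enorm (y - x') ^+ 2 in h2 *.
lra.
Qed.

(** At [x'] the penalty is exactly [|lam'|^2] by the multiplier update. At [y] the linearized
    constraints lie below [G y z], and [pos t ^+ 2 <= t ^+ 2] opens the square, producing
    [dot lam (G y z)]. *)
Lemma prox_Lagrangian_bound y : C y ->
  dot (v0 x z) (x' - x) + (enorm lam' ^+ 2 - enorm lam ^+ 2) / (2 * sigma)
    + alpha / 2 * enorm (x' - x) ^+ 2 + alpha / 2 * enorm (y - x') ^+ 2
  <= dot (v0 x z) (y - x) + dot lam (G y z) + sigma / 2 * enorm (G y z) ^+ 2
    + alpha / 2 * enorm (y - x) ^+ 2.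
Proof.
move=> Cy; have s0 := sigma_gt0.
have := prox_three_point Cy; rewrite /L /Lsig.
have -> : \sum_(i < p) pos (lam 0 i + sigma * (G x z 0 i
    + dot (v i x z) (x' - x))) ^+ 2 = enorm lam' ^+ 2.
  by rewrite sqr_enormE; apply: eq_bigr => i _; rewrite lam'E.
have h : \sum_(i < p) pos (lam 0 i + sigma * (G x z 0 i
    + dot (v i x z) (y - x))) ^+ 2 <=
    enorm lam ^+ 2 + 2 * sigma * dot lam (G y z) + sigma ^+ 2 * enorm (G y z) ^+ 2.
  rewrite !sqr_enormE /dot !mulr_sumr -!big_split; apply: ler_sum => i _ /=.
  apply: (@le_trans _ _ (pos (lam 0 i + sigma * G y z 0 i) ^+ 2)).
    by apply: ler_pos_sqr; rewrite lerD2l ler_pM2l// subG.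
  by apply: (le_trans (pos_sqr_le _)); rewrite le_eqVlt; apply/orP; left; apply/eqP; ring.
have s2 : 0 <= (2 * sigma)^-1 by rewrite invr_ge0 mulr_ge0// ltW.
have := ler_wpM2l s2 h.
rewrite [X in _ <= X -> _](_ : _ = (2 * sigma)^-1 * enorm lam ^+ 2
  + dot lam (G y z) + sigma / 2 * enorm (G y z) ^+ 2); last by field; lra.
set S := \sum_(i < p) _; lra.
Qed.

Lemma prox_objective_bound y : C y ->
  F x z - F y z <= kappa_f ^+ 2 / (2 * alpha) + sigma / 2 * nu_g ^+ 2
    + dot lam (G y z) + (enorm lam ^+ 2 - enorm lam' ^+ 2) / (2 * sigma)
    + alpha / 2 * (enorm (y - x) ^+ 2 - enorm (y - x') ^+ 2).
Proof.
move=> Cy; have s0 := sigma_gt0; have a0 := alpha_gt0.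
have := prox_Lagrangian_bound Cy.
have := subF z Cx Cy.
have hG : enorm (G y z) ^+ 2 <= nu_g ^+ 2.
  have := boundG z Cy; have := enorm_ge0 (G y z) => h0 h1.
  by rewrite ler_pXn2r ?nnegrE//; lra.
have := ler_wpM2l (divr_ge0 (ltW sigma_gt0) (ler0n _ 2)) hG.
have hv : - (kappa_f * enorm (x' - x)) <= dot (v0 x z) (x' - x).
  have := normr_dot_le (v0 x z) (x' - x); rewrite ler_norml => /andP[+ _].
  apply: le_trans; rewrite lerN2; apply: ler_wpM2r; first exact: enorm_ge0.
  exact: boundv0.
(* Completing the square: the proximal term absorbs the linear term [kappa_f * |x' - x|] at the
   price [kappa_f ^+ 2 / (2 * alpha)]. *)
have := sqr_ge0 (kappa_f - alpha * enorm (x' - x)).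
set e := enorm (x' - x) in hv *.
move=> hs.
have : 0 <= kappa_f ^+ 2 / (2 * alpha) - kappa_f * e + alpha / 2 * e ^+ 2.
  rewrite [X in 0 <= X](_ : _ = (kappa_f - alpha * e) ^+ 2 / (2 * alpha)).
    by rewrite divr_ge0// mulr_ge0// ltW.
  by field; lra.
set S := (_ - _) / (2 * sigma).
rewrite (_ : (enorm lam ^+ 2 - _) / (2 * sigma) = - S); last by rewrite /S; ring.
lra.
Qed.

Lemma prox_drift_bound y : C y ->
  enorm lam' ^+ 2 - enorm lam ^+ 2 <= 2 * sigma * (kappa_f * Rd + sigma / 2 * nu_g ^+ 2
    + dot lam (G y z) + alpha / 2 * (enorm (y - x) ^+ 2 - enorm (y - x') ^+ 2)).
Proof.
move=> Cy; have s0 := sigma_gt0; have a0 := alpha_gt0.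
have := prox_Lagrangian_bound Cy.
have hG : enorm (G y z) ^+ 2 <= nu_g ^+ 2.
  have := boundG z Cy; have := enorm_ge0 (G y z) => h0 h1.
  by rewrite ler_pXn2r ?nnegrE//; lra.
have := ler_wpM2l (divr_ge0 (ltW sigma_gt0) (ler0n _ 2)) hG.
have hv : dot (v0 x z) (y - x) - dot (v0 x z) (x' - x) <= kappa_f * Rd.
  rewrite -dotNr -dotDr opprB addrA subrK.
  apply: (le_trans (dot_le_enorm _ _)).
  by apply: ler_pM; rewrite ?enorm_ge0 ?boundv0 ?diamC.
have := mulr_ge0 (divr_ge0 (ltW alpha_gt0) (ler0n _ 2)) (sqr_ge0 (enorm (x' - x))).
set D := enorm lam' ^+ 2 - _.
move=> h1 h2 h3.
have s2 : 0 < 2 * sigma by lra.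
rewrite -ler_pdivrMl// mulrC; lra.
Qed.

(** Since [lam] is nonnegative, [pos] does not increase the distance to it, so each coordinate moves
    by at most [sigma] times a linearized constraint. *)
Lemma multiplier_increment : `|enorm lam' - enorm lam| <= sigma * beta0 p nu_g kappa_g Rd.
Proof.
apply: (le_trans (enormB_le _ _)).
pose u : 'rV[R]_p := \row_i dot (v i x z) (x' - x).
have hu : enorm u <= Num.sqrt p%:R * (kappa_g * Rd).
  have Rd0 : 0 <= Rd by rewrite (le_trans _ (diamC Cx Cx))// enorm_ge0.
  (* The sign of [kappa_g] is known only if there is a constraint; for [p = 0] the term with
     [kappa_g] vanishes. *)
  case: (posnP p) => [p0|p0].
    have -> : enorm u = 0.
      rewrite /enorm /dot big1 ?sqrtr0// => -[i ip]; exfalso; move: ip; rewrite p0 => ip.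
      by [].
    rewrite p0 sqrtr0 mul0r//.
  have kg0 : 0 <= kappa_g.
    by rewrite (le_trans _ (boundv (Ordinal p0) z Cx))// enorm_ge0.
  apply: enorm_le_const => [|j]; first exact: mulr_ge0.
  rewrite mxE (le_trans (normr_dot_le _ _))//.
  by apply: ler_pM; rewrite ?enorm_ge0 ?boundv ?diamC.
have : enorm (lam' - lam) <= enorm (sigma *: (G x z + u)).
  apply: le_enorm => i; rewrite !mxE lam'E.
  apply: (le_trans (pos_dist_le _ (lam_ge0 i))).
  by rewrite addrAC subrr add0r.
move=> /le_trans; apply; rewrite enormZ gtr0_norm// ler_pM2l//.
by rewrite (le_trans (enormD _ _))// /beta0 -mulrA lerD// boundG.
Qed.

(** Taking [y := x] in [prox_three_point] counts the squared displacement twice. The decrease of the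
    Lagrangian is at most linear in the displacement by [pos_sqr_tangent], so one factor cancels. *)
Lemma prox_step_bound :
  alpha * enorm (x' - x) <=
    kappa_f + kappa_g * (Num.sqrt p%:R * (enorm lam + sigma * nu_g)).
Proof.
have kf0 : 0 <= kappa_f by rewrite (le_trans _ (boundv0 z Cx))// enorm_ge0.
set e := enorm (x' - x).
have e0 : 0 <= e by exact: enorm_ge0.
pose a i := lam 0 i + sigma * G x z 0 i.
have hs : kappa_g * \sum_(i < p) pos (a i) <=
    kappa_g * (Num.sqrt p%:R * (enorm lam + sigma * nu_g)).
  case: (posnP p) => [p0|p0].
    rewrite big1 ?mulr0; last by move=> -[i ip]; exfalso; move: ip; rewrite p0.
    by rewrite (_ : p%:R = 0) ?sqrtr0 ?mul0r ?mulr0// p0.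
  have kg0 : 0 <= kappa_g.
    by rewrite (le_trans _ (boundv (Ordinal p0) z Cx))// enorm_ge0.
  apply: ler_wpM2l => //.
  pose u : 'rV[R]_p := \row_i pos (a i).
  have := sum_le_enorm u; under eq_bigr do rewrite mxE.
  move=> /le_trans; apply; rewrite ler_wpM2l ?sqrtr_ge0//.
  have : enorm u <= enorm (lam + sigma *: G x z).
    apply: le_enorm => i; rewrite !mxE (ger0_norm (pos_ge0 _)).
    exact: pos_le_norm.
  move=> /le_trans; apply; apply: (le_trans (enormD _ _)).
  by rewrite lerD2l enormZ gtr0_norm// ler_wpM2l ?boundG// ltW.
have s0 := sigma_gt0.
have := prox_three_point Cx; rewrite /L /Lsig !subrr.
have -> : enorm (0 : 'rV[R]_n) = 0.
  by rewrite /enorm /dot big1 ?sqrtr0// => j _; rewrite mxE mul0r.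
rewrite -(enormN (x - x')) opprB -/e.
have d0 (u : 'rV[R]_n) : dot u 0 = 0 by rewrite -(scale0r (0 : 'rV_n)) dotZr mul0r.
rewrite d0; under [X in _ <= _ + _ * (X - _) + _ -> _]eq_bigr do rewrite d0 addr0.
set S1 := \sum_(i < p) _; set S2 := \sum_(i < p) _ => h.
have hS : S2 - S1 <= 2 * sigma * (kappa_g * e * \sum_(i < p) pos (a i)).
  rewrite /S2 /S1 -sumrB !mulr_sumr; apply: ler_sum => i _.
  apply: (le_trans (pos_sqr_tangent _ _)).
  rewrite [X in _ <= X](_ : _ = 2 * pos (a i) * (sigma * (kappa_g * e))); last by ring.
  apply: ler_wpM2l; first by rewrite mulr_ge0// pos_ge0.
  rewrite [X in X <= _](_ : _ = sigma * (- dot (v i x z) (x' - x))); last by ring.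
  rewrite ler_pM2l// -dotNr (le_trans (dot_le_enorm _ _))// enormN.
  by rewrite ler_wpM2r// boundv.
have hv : - (kappa_f * e) <= dot (v0 x z) (x' - x).
  have := normr_dot_le (v0 x z) (x' - x); rewrite ler_norml => /andP[+ _].
  apply: le_trans; rewrite lerN2; apply: ler_wpM2r; first exact: enorm_ge0.
  exact: boundv0.
have s2 : 0 <= (2 * sigma)^-1 by rewrite invr_ge0 mulr_ge0// ltW.
have := ler_wpM2l s2 hS.
rewrite [X in _ <= X -> _](_ : _ = e * (kappa_g * \sum_(i < p) pos (a i))); last by field; lra.
move=> hS'.
have := ler_wpM2l e0 hs => hs'.
have hfin : e * (alpha * e) <= e * (kappa_f + kappa_g * (Num.sqrt p%:R * (enorm lam + sigma * nu_g))).
  move: h hv hs' hS'; lra.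
have [e00|ene] := eqVneq e 0.
  rewrite e00 mulr0 addr_ge0//; apply: le_trans hs.
  case: (posnP p) => [p0|p0].
    by rewrite big1 ?mulr0//; move=> -[i ip]; exfalso; move: ip; rewrite p0.
  by rewrite mulr_ge0 ?sumr_ge0// => [|i _]; rewrite ?pos_ge0// (le_trans _ (boundv (Ordinal p0) z Cx))// enorm_ge0.
by rewrite -(ler_pM2l (_ : 0 < e))// lt_def ene.
Qed.

(** Read backwards, this bounds [G x z 0 i] by a telescoping multiplier difference plus a step
    length. *)
Lemma multiplier_increase i :
  sigma * (G x z 0 i - kappa_g * enorm (x' - x)) <= lam' 0 i - lam 0 i.
Proof.
rewrite lam'E; have := le_pos (lam 0 i + sigma * (G x z 0 i + dot (v i x z) (x' - x))).
have hv : - (kappa_g * enorm (x' - x)) <= dot (v i x z) (x' - x).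
  have := normr_dot_le (v i x z) (x' - x); rewrite ler_norml => /andP[+ _].
  apply: le_trans; rewrite lerN2; apply: ler_wpM2r; first exact: enorm_ge0.
  exact: boundv.
have := ler_wpM2l (ltW sigma_gt0) hv; lra.
Qed.

End LinearizedStep.

(** * Bounded measurable functions and independence *)

Section BoundedMeasurable.
Context {R : realType} {d : measure_display} {T : measurableType d}.
Implicit Types f g : T -> R.

(** A class closed under the operations used below and integrable for every probability. The
    sigma-algebra sits in the type [T], so the same predicate on [past k] expresses adaptedness. *)
Definition bmfun f := measurable_fun [set: T] f /\ exists M, forall t, `|f t| <= M.

Lemma bmfun_cst (c : R) : bmfun (fun=> c).
Proof. by split; [exact: measurable_cst|exists `|c|]. Qed.

Lemma bmfunD f g : bmfun f -> bmfun g -> bmfun (fun t => f t + g t).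
Proof.
move=> [mf [M hM]] [mg [N hN]]; split; first exact: measurable_funD.
by exists (M + N) => t; rewrite (le_trans (ler_normD _ _))// lerD.
Qed.

Lemma bmfunM f g : bmfun f -> bmfun g -> bmfun (fun t => f t * g t).
Proof.
move=> [mf [M hM]] [mg [N hN]]; split; first exact: measurable_funM.
by exists (M * N) => t; rewrite normrM ler_pM.
Qed.

Lemma bmfunN f : bmfun f -> bmfun (fun t => - f t).
Proof.
move=> [mf [M hM]]; split; first exact: measurable_funN.
by exists M => t; rewrite normrN.
Qed.

Lemma bmfunB f g : bmfun f -> bmfun g -> bmfun (fun t => f t - g t).
Proof. by move=> bf bg; apply: bmfunD => //; exact: bmfunN. Qed.

Lemma bmfunZ (c : R) f : bmfun f -> bmfun (fun t => c * f t).
Proof. by move=> bf; apply: bmfunM => //; exact: bmfun_cst. Qed.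

Lemma bmfun_sum (I : Type) (s : seq I) (F : I -> T -> R) :
  (forall i, bmfun (F i)) -> bmfun (fun t => \sum_(i <- s) F i t).
Proof.
move=> bF; elim: s => [|i s ih].
  rewrite (_ : (fun t => _) = fun=> 0); first exact: bmfun_cst.
  by apply/funext => t; rewrite big_nil.
rewrite (_ : (fun t => _) = fun t => F i t + \sum_(j <- s) F j t).
  exact: bmfunD.
by apply/funext => t; rewrite big_cons.
Qed.

Context (P : probability T R).

Lemma bmfun_integrable f : bmfun f -> P.-integrable [set: T] (EFin \o f).
Proof.
move=> [mf [M hM]]; apply: measurable_bounded_integrable => //.
  by rewrite /= probability_setT ltry.
exists M; split; first exact: num_real.
by move=> N MN t _; rewrite /= (le_trans (hM t))// ltW.
Qed.

Lemma expectation_bmfun f : bmfun f -> 'E_P[f]%E = (\int[P]_w f w)%:E.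
Proof.
move=> /bmfun_integrable bf.
by rewrite unlock /Rintegral fineK// integrable_fin_num.
Qed.

Lemma Rint_cst (c : R) : \int[P]_w c = c.
Proof. by rewrite Rintegral_cst//= probability_setT mulr1. Qed.

Lemma RintD f g : bmfun f -> bmfun g ->
  \int[P]_w (f w + g w) = \int[P]_w f w + \int[P]_w g w.
Proof. by move=> bf bg; rewrite RintegralD//; exact: bmfun_integrable. Qed.

Lemma RintB f g : bmfun f -> bmfun g ->
  \int[P]_w (f w - g w) = \int[P]_w f w - \int[P]_w g w.
Proof. by move=> bf bg; rewrite RintegralB//; exact: bmfun_integrable. Qed.

Lemma RintZ (c : R) f : bmfun f -> \int[P]_w (c * f w) = c * \int[P]_w f w.
Proof. by move=> bf; rewrite RintegralZl//; exact: bmfun_integrable. Qed.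

Lemma Rint_le f g : bmfun f -> bmfun g -> (forall w, f w <= g w) ->
  \int[P]_w f w <= \int[P]_w g w.
Proof.
by move=> bf bg fg; apply: le_Rintegral => //; exact: bmfun_integrable.
Qed.

Lemma Rint_sum (I : Type) (s : seq I) (F : I -> T -> R) :
  (forall i, bmfun (F i)) ->
  \int[P]_w (\sum_(i <- s) F i w) = \sum_(i <- s) \int[P]_w F i w.
Proof.
move=> bF; elim: s => [|i s ih].
  by under eq_Rintegral do rewrite big_nil; rewrite Rint_cst big_nil.
under eq_Rintegral do rewrite big_cons.
by rewrite RintD ?ih ?big_cons//; exact: bmfun_sum.
Qed.

Lemma Rint_norm_le f (M : R) : bmfun f -> (forall w, `|f w| <= M) ->
  `|\int[P]_w f w| <= M.
Proof.
move=> bf fM; rewrite ler_norml -(Rint_cst (- M)) -[X in _ && (_ <= X)](Rint_cst M).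
by apply/andP; split; (apply: Rint_le => //; first exact: bmfun_cst) => w;
  have := fM w; rewrite ler_norml => /andP[].
Qed.

End BoundedMeasurable.

(** * Integrating out an independent variable *)

Section IndependentFubini.
Context {R : realType} {d1 d2 : measure_display}.
Context {T1 : measurableType d1} {T2 : measurableType d2}.

Lemma bmfun_section (h : T1 -> T2 -> R) x :
  bmfun (fun t : T1 * T2 => h t.1 t.2) -> bmfun (h x).
Proof.
move=> [mh [M hM]]; split; last by exists M => z; exact: (hM (x, z)).
exact: (measurableT_comp mh (@pair1_measurable _ _ T1 T2 x)).
Qed.

Lemma bmfun_Rintegral (mu : probability T2 R) (h : T1 -> T2 -> R) :
  bmfun (fun t : T1 * T2 => h t.1 t.2) -> bmfun (fun x => \int[mu]_z h x z).
Proof.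
move=> bh; have [mh [M hM]] := bh; split; last first.
  exists M => x; apply: Rint_norm_le; first exact: bmfun_section.
  by move=> z; exact: (hM (x, z)).
(* Adding the bound [M] makes the integrand nonnegative, as Tonelli measurability requires. *)
pose g (t : T1 * T2) := (h t.1 t.2 + M)%:E.
have mg : measurable_fun setT g.
  by apply/measurable_EFinP; apply: measurable_funD => //; exact: measurable_cst.
have g0 t : (0 <= g t)%E.
  by rewrite lee_fin; have := hM t; rewrite ler_norml; lra.
have mG := measurable_fun_fubini_tonelli_F (m2 := mu) g mg g0.
have -> : (fun x => \int[mu]_z h x z) = (fun x => fine (fubini_F mu g x) - M).
  apply/funext => x; rewrite -[fine _]/(\int[mu]_z (h x z + M)).
  rewrite RintD ?Rint_cst ?addrK//; [exact: bmfun_section|exact: bmfun_cst].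
apply: measurable_funB; last exact: measurable_cst.
exact: (measurableT_comp (@fine_measurable R setT measurableT)).
Qed.

Context {dO : measure_display} {Omega : measurableType dO}.
Context (P : probability Omega R) (mu : probability T2 R).
Context (X : Omega -> T1) (Z : Omega -> T2).
Hypothesis mX : measurable_fun [set: Omega] X.
Hypothesis mZ : measurable_fun [set: Omega] Z.
Hypothesis XZ : forall A B, measurable A -> measurable B ->
  P (X @^-1` A `&` Z @^-1` B) = (P (X @^-1` A) * mu B)%E.

(** Independence says that the law of [(X, Z)] agrees with the product law on rectangles; they are
    therefore equal, and Fubini applies. *)
Lemma Rintegral_indep (h : T1 -> T2 -> R) :
  bmfun (fun t : T1 * T2 => h t.1 t.2) ->
  \int[P]_w h (X w) (Z w) = \int[P]_w (\int[mu]_z h (X w) z).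
Proof.
move=> bh; have [mh [M hM]] := bh.
pose X' : {mfun Omega >-> T1} := mfun_Sub (mem_set mX).
have mXZ : measurable_fun [set: Omega] (fun w => (X w, Z w)).
  exact: measurable_fun_pair.
pose XZ' : {mfun Omega >-> (T1 * T2)%type} := mfun_Sub (mem_set mXZ).
pose g (t : T1 * T2) := (h t.1 t.2)%:E.
have mg : measurable_fun setT g by exact/measurable_EFinP.
have E A : measurable A ->
    (distribution P X' \x mu)%E A = distribution P XZ' A.
  by move=> mA; apply: (product_measure_unique (m' := distribution P XZ')).
have ig : (distribution P X' \x mu)%E.-integrable setT g.
  apply/integrable12ltyP => //.
  apply: (@le_lt_trans _ _ (\int[distribution P X']_x (\int[mu]_y (M%:E)))%E).
    apply: ge0_le_integral => //.
    - by move=> x _; exact: integral_ge0.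
    - apply: (@measurable_fun_fubini_tonelli_F _ _ _ _ _ mu (abse \o g)).
        exact: measurableT_comp.
      by move=> z; exact: abse_ge0.
    - move=> x _; apply: ge0_le_integral => //.
      + apply: measurableT_comp => //; apply: (measurableT_comp mg).
        exact: pair1_measurable.
      + by move=> z _ /=; rewrite lee_fin; exact: (hM (x, z)).
  have muM : (\int[mu]_y M%:E = M%:E)%E.
    by rewrite integral_cst//= probability_setT mule1.
  by rewrite muM integral_cst//= probability_setT mule1 ltry.
have -> : \int[P]_w h (X w) (Z w) =
    fine (\int[distribution P XZ']_t g t)%E.
  rewrite integral_distribution//.
  apply: bmfun_integrable; split; first exact: (measurableT_comp mh mXZ).
  by exists M => w; exact: (hM (X w, Z w)).
rewrite -(eq_measure_integral _ (fun A mA _ => E A mA)).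
rewrite -(integral12_prod_meas1 ig).
have bG := bmfun_Rintegral mu bh.
have FE x : fubini_F mu g x = (\int[mu]_z h x z)%:E.
  rewrite /Rintegral fineK//; apply: integrable_fin_num => //.
  by apply: bmfun_integrable; exact: bmfun_section.
rewrite (eq_integral (fun x => (\int[mu]_z h x z)%:E)); last by move=> x _.
rewrite integral_distribution//; first by apply/measurable_EFinP; case: bG.
apply: bmfun_integrable; case: bG => mG [N hN]; split; last by exists N.
exact: (measurableT_comp mG mX).
Qed.

End IndependentFubini.

(** * The past sigma-algebras of the samples *)

Section Filtration.
Context {R : realType} {d dO : measure_display}.
Context {Xi : measurableType d} {Omega : measurableType dO}.
Context (P : probability Omega R) (mu : probability Xi R) (xi : nat -> Omega -> Xi).

(* The pi-system generating the past sigma-algebra, in the product form that the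
   independence hypothesis on the samples speaks about. *)
Definition past_cylinder k : set (set Omega) :=
  [set B | exists A : nat -> set Xi, (forall j, measurable (A j)) /\
     B = \big[setI/setT]_(j <- iota 0 k) (xi j @^-1` A j)].

(** [Omega] with the smaller sigma-algebra generated by the samples of index below [k], as a type of
    its own. *)
Definition past k := g_sigma_algebraType (past_cylinder k).

Lemma iota_rcons k : iota 0 k.+1 = rcons (iota 0 k) k.
Proof. by rewrite -addn1 iotaD add0n cats1. Qed.

Lemma big_past_set (A : nat -> set Xi) (B : set Xi) k :
  \big[setI/setT]_(j <- iota 0 k.+1) (xi j @^-1` (if j == k then B else A j)) =
  \big[setI/setT]_(j <- iota 0 k) (xi j @^-1` A j) `&` xi k @^-1` B.
Proof.
rewrite iota_rcons -cats1 big_cat big_seq1 eqxx; congr (_ `&` _).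
apply: eq_big_seq => j; rewrite mem_iota add0n => /andP[_ jk].
by rewrite (ltn_eqF jk).
Qed.

Lemma past_cylinderS k : past_cylinder k `<=` past_cylinder k.+1.
Proof.
move=> B [A [mA ->]]; exists (fun j => if j == k then setT else A j); split.
  by move=> j; case: ifP.
by rewrite big_past_set preimage_setT setIT.
Qed.

Lemma past_le k l : (k <= l)%N -> past_cylinder k `<=` past_cylinder l.
Proof.
elim: l => [|l ih]; first by rewrite leqn0 => /eqP ->.
rewrite leq_eqVlt => /predU1P[->//|kl].
exact: subset_trans (ih kl) (@past_cylinderS l).
Qed.

Lemma measurable_past_le {d' : measure_display} {T : measurableType d'} k l
    (f : Omega -> T) : (k <= l)%N ->
  measurable_fun [set: past k] f -> measurable_fun [set: past l] f.
Proof.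
move=> kl mf _ Y mY; have := mf measurableT Y mY.
apply: sub_sigma_algebra2; exact: past_le.
Qed.

Lemma measurable_past_sample k : measurable_fun [set: past k.+1] (xi k).
Proof.
move=> _ Y mY; rewrite setTI; apply: sub_sigma_algebra.
exists (fun j => if j == k then Y else setT); split; first by move=> j; case: ifP.
by rewrite (big_past_set (fun=> setT)) big1 ?setTI.
Qed.

Hypothesis iid : iid_with_law P mu xi.

Lemma past_cylinder_measurable k : past_cylinder k `<=` measurable.
Proof.
move=> _ [A [mA ->]]; apply: bigsetI_measurable => j _.
by rewrite -[X in measurable X]setTI; apply: (iid.1 j).
Qed.

Lemma measurable_past {d' : measure_display} {T : measurableType d'} k
    (f : Omega -> T) : measurable_fun [set: past k] f -> measurable_fun [set: Omega] f.
Proof.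
move=> mf _ Y mY; have := mf measurableT Y mY.
apply: smallest_sub; first exact: sigma_algebra_measurable.
exact: past_cylinder_measurable.
Qed.

(** With [B] fixed, both sides are finite measures in [A] that agree on the pi-system of cylinders;
    on a cylinder, [big_past_set] absorbs the event on [xi k] into a longer cylinder. *)
Lemma past_indep k (A : set Omega) (B : set Xi) :
  <<s past_cylinder k >> A -> measurable B ->
  P (A `&` xi k @^-1` B) = (P A * mu B)%E.
Proof.
move=> sA mB; have [mxi [law indep]] := iid.
have mE : measurable (xi k @^-1` B).
  by rewrite -[X in measurable X]setTI; exact: mxi.
have r0 : 0 <= fine (mu B) by exact: fine_ge0.
have E : (mscale (NngNum r0) P : {measure set Omega -> \bar R}) A =
    (P A * mu B)%E.
  rewrite -[LHS]/((fine (mu B))%:E * P A)%E.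
  by rewrite muleC fineK// fin_num_measure.
rewrite -E -[LHS]/(mrestr P mE A).
apply: (g_sigma_algebra_measure_unique (past_cylinder k) _ (fun=> setT)) => //.
- exact: past_cylinder_measurable.
- move=> _; exists (fun=> setT); split => //.
  by rewrite big1// => j _; rewrite preimage_setT.
- by rewrite bigcup_const.
- move=> _ _ [A1 [mA1 ->]] [A2 [mA2 ->]].
  exists (fun j => A1 j `&` A2 j); split; first by move=> j; exact: measurableI.
  by rewrite -big_split/=; apply: eq_bigr => j _; rewrite preimage_setI.
- move=> _ [A1 [mA1 ->]].
  pose CA := \big[setI/setT]_(j <- iota 0 k) (xi j @^-1` A1 j).
  rewrite -/CA -[LHS]/(P (CA `&` xi k @^-1` B)) -[RHS]/((fine (mu B))%:E * P CA)%E.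
  rewrite /CA -big_past_set indep ?iota_uniq//; last by move=> j; case: ifP.
  rewrite iota_rcons -cats1 big_cat big_seq1 eqxx /= indep ?iota_uniq//.
  rewrite muleC law// fineK ?fin_num_measure//; congr (_ * _)%E.
  apply: eq_big_seq => j; rewrite mem_iota add0n => /andP[_ jk].
  by rewrite (ltn_eqF jk).
- move=> _; rewrite -[X in (X < _)%E]/(P (setT `&` xi k @^-1` B)).
  apply: (@le_lt_trans _ _ 1%E); last exact: ltry.
  by apply: probability_le1; exact: measurableI.
Qed.

Lemma bmfun_past k (f : Omega -> R) : @bmfun R _ (past k) f -> bmfun f.
Proof. by move=> [mf bf]; split => //; exact: measurable_past mf. Qed.

Lemma bmfun_past_le k l (f : Omega -> R) : (k <= l)%N ->
  @bmfun R _ (past k) f -> @bmfun R _ (past l) f.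
Proof. by move=> kl [mf bf]; split => //; exact: measurable_past_le mf. Qed.

(** [Rintegral_indep] for the identity map from [Omega] to [past k]: the integrand may depend on the
    whole past at once. *)
Lemma Rintegral_past k (h : Omega -> Xi -> R) :
  bmfun (fun t : past k * Xi => h t.1 t.2) ->
  \int[P]_w h w (xi k w) = \int[P]_w (\int[mu]_z h w z).
Proof.
move=> bh; apply: (@Rintegral_indep R _ _ (past k) Xi _ Omega P mu id (xi k)) => //.
- by apply: (@measurable_past _ (past k) k); exact: measurable_id.
- exact: iid.1.
- by move=> A B mA mB; exact: past_indep.
Qed.

End Filtration.

(** * Measurability of the argmin *)

Section ArgminMeasurable.
Context {R : realType} {n : nat} (C : set 'rV[R]_n).

(* [x0] is a junk value, taken when [C] has no point that close to [q]. *)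
Definition rational_net (x0 : 'rV[R]_n) (qN : 'rV[rat]_n * nat) : 'rV[R]_n :=
  if pselect (exists y, C y /\ forall j, `|y 0 j - ratr (qN.1 0 j)| < (qN.2.+1%:R)^-1)
    is left h then sval (cid h) else x0.

Lemma rational_net_in x0 qN : C x0 -> C (rational_net x0 qN).
Proof. by rewrite /rational_net; case: pselect => // h _; case: cid => y []. Qed.

Lemma rational_net_dense x0 x (e : R) : C x -> 0 < e ->
  exists qN, forall j, `|rational_net x0 qN 0 j - x 0 j| < e.
Proof.
(* Two errors of size [1 / N.+1] add up: from the net point to the rational vector, and from there
   to [x]. *)
move=> Cx e0; pose N := Num.truncn (2 / e).
have N0 : 0 < (N.+1%:R : R)^-1 by rewrite invr_gt0.
have hN : (N.+1%:R : R)^-1 + N.+1%:R^-1 < e.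
  have : 2 / e < N.+1%:R by exact: truncnS_gt.
  rewrite ltr_pdivrMr// => h.
  rewrite [ltLHS](_ : _ = 2 / N.+1%:R); last by rewrite mulr_natl mulr2n.
  by rewrite ltr_pdivrMr// mulrC.
set r := N.+1%:R^-1 in N0 hN.
have hq j : exists q : rat, `|x 0 j - ratr q| < r.
  have /rat_in_itvoo[q] : x 0 j - r < x 0 j + r by lra.
  by rewrite in_itv/= => /andP[h1 h2]; exists q; rewrite ltr_norml; lra.
pose q : 'rV[rat]_n := \row_j sval (cid (hq j)).
exists (q, N) => j; rewrite /rational_net; case: pselect => [h|[]]; last first.
  by exists x; split => // i; rewrite /= mxE; case: cid.
case: cid => y [Cy hy] /=.
have := hy j; rewrite /= mxE; case: cid => s hs /= hy'.
rewrite -(subrKA (ratr s)) (le_lt_trans (ler_normD _ _))//.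
rewrite (distrC (ratr s)); exact: lt_trans (ltrD hy' hs) hN.
Qed.

(** The minimal value is a countable infimum. A coordinate of the minimizer is recovered by
    penalization: strong convexity limits how far the coordinate can fall for a given excess of
    [phi]. *)
Lemma measurable_rV_argmin {d : measure_display} {T : measurableType d}
    (phi : T -> 'rV[R]_n -> R) (c : R) (x : T -> 'rV[R]_n) :
  0 < c -> (forall t, C (x t)) ->
  (forall t, continuous (phi t)) ->
  (forall y, measurable_fun [set: T] (fun t => phi t y)) ->
  (forall t y, C y -> phi t (x t) + c * enorm (y - x t) ^+ 2 <= phi t y) ->
  forall j, measurable_fun [set: T] (fun t => x t 0 j).
Proof.
move=> c0 Cx cphi mphi strong j.
(* Numbers that encode no index fall back on [x point], which lies in [C]. *)
pose net m := odflt (x point) (omap (rational_net (x point)) (unpickle m)).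
have netC m : C (net m).
  by rewrite /net; case: unpickle => [qN|] /=; [exact: rational_net_in|exact: Cx].
have near_min t (e : R) : 0 < e ->
    exists m, phi t (net m) < phi t (x t) + e /\ net m 0 j < x t 0 j + e.
  move=> e0; have := cphi t (x t) => /cvgrPdist_lt/(_ e e0).
  move=> /nbhs_ballP[r /= r0 hr].
  have er0 : 0 < Num.min e r by rewrite lt_min e0.
  have [qN hq] := rational_net_dense (x point) (Cx t) er0.
  exists (pickle qN); rewrite /net pickleK/=.
  have hb : ball (x t) r (rational_net (x point) qN).
    split => // i k; rewrite (ord1 i) /ball/= distrC (lt_le_trans (hq k))//.
    by rewrite ge_min lexx orbT.
  split.
    by have := hr _ hb; rewrite /= distrC ltr_norml; lra.
  have := lt_le_trans (hq j) (_ : _ <= e); rewrite ge_min lexx => /(_ isT).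
  by rewrite ltr_norml; lra.
have mv : measurable_fun [set: T] (fun t => phi t (x t)).
  apply: (measurability _ (RGenInftyO.measurableE R)) => //.
  move=> _ [_ [a ->] <-]; rewrite setTI.
  rewrite [X in measurable X](_ : _ = \bigcup_m [set t | phi t (net m) < a]).
    apply: bigcupT_measurable => m.
    have := mphi (net m) measurableT _ (measurable_itv `]-oo, a[).
    by rewrite setTI; congr (measurable _); apply/seteqP; split => t /=; rewrite in_itv.
  apply/seteqP; split => t /=; rewrite in_itv/=.
    rewrite -subr_gt0 => /(near_min t)[m [h _]]; exists m => //=; lra.
  move=> [m _] /=; apply: le_lt_trans; apply: le_trans (strong t _ (netC m)).
  by rewrite lerDl mulr_ge0 ?sqr_ge0// ltW.
apply: (measurability _ (RGenOInfty.measurableE R)) => //.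
move=> _ [_ [a ->] <-]; rewrite setTI.
pose u N m t := net m 0 j + N.+1%:R * (phi t (net m) - phi t (x t)).
(* [x j] is the supremum over [N] of [inf_y (y j + N * (phi y - phi x))]. *)
rewrite [X in measurable X](_ : _ =
    \bigcup_N \bigcap_m [set t | a + N.+1%:R^-1 <= u N m t]).
  apply: bigcupT_measurable => N; apply: bigcapT_measurable => m.
  have mu : measurable_fun [set: T] (u N m).
    apply: measurable_funD; first exact: measurable_cst.
    apply: measurable_funM; first exact: measurable_cst.
    exact: measurable_funB.
  have := mu measurableT _ (measurable_itv `[a + N.+1%:R^-1, +oo[).
  by rewrite setTI; congr (measurable _); apply/seteqP; split => t /=; rewrite in_itv/= andbT.
apply/seteqP; split => t /=; rewrite in_itv/= andbT.
(* With [e] the coordinate difference, [N.+1 * c * e ^+ 2 + e] is at least [- 1 / (4 * c * N.+1)].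
   The gap [x j - a] must cover this loss and the slack [1 / N.+1], that is [b / N.+1]. *)
- move=> ax; pose b := 1 + (4 * c)^-1.
  have b0 : 0 < b by rewrite addr_gt0// invr_gt0 mulr_gt0.
  pose N := Num.truncn (b / (x t 0 j - a)).
  exists N => // m _; rewrite /= /u.
  have N0 : 0 < (N.+1%:R : R) by [].
  have hN : b / N.+1%:R <= x t 0 j - a.
    have : b / (x t 0 j - a) < N.+1%:R by exact: truncnS_gt.
    by rewrite ltr_pdivrMr ?subr_gt0// mulrC -ltr_pdivrMr// => /ltW.
  have h := strong t _ (netC m).
  pose e := net m 0 j - x t 0 j.
  have he : e ^+ 2 <= enorm (net m - x t) ^+ 2.
    rewrite -(real_normK (num_real e)) ler_pXn2r ?nnegrE ?enorm_ge0//.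
    by have := normr_coord_le (net m - x t) j; rewrite !mxE.
  have h2 : N.+1%:R * (c * e ^+ 2) <= N.+1%:R * (phi t (net m) - phi t (x t)).
    by rewrite ler_pM2l//; have := ler_wpM2l (ltW c0) he; lra.
  have h3 : 0 <= N.+1%:R * (c * e ^+ 2) + e + (4 * c)^-1 / N.+1%:R.
    rewrite [X in 0 <= X](_ : _ = (2 * c * N.+1%:R * e + 1) ^+ 2 / (4 * c * N.+1%:R)).
      by rewrite divr_ge0 ?sqr_ge0// !mulr_ge0// ltW.
    by move: (N.+1%:R : R) N0 => K K0; field; rewrite !gt_eqF.
  move: hN; rewrite /b mulrDl mul1r => hN.
  move: h2 h3 hN; rewrite /e.
  move: (N.+1%:R * (phi _ _ - _)) (N.+1%:R * (c * _)) => A B.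
  by move: ((4 * c)^-1 / _) => D; move: (N.+1%:R^-1) => E; lra.
(* The slack gives the strict inequality. If [x j] were below [a + 1 / N.+1], a net point close to
   [x t] would violate the bound on [u]. *)
- move=> [N _ hN]; apply: (@lt_le_trans _ _ (a + N.+1%:R^-1)).
    by rewrite ltrDl invr_gt0.
  rewrite leNgt; apply/negP => lt.
  pose e := a + N.+1%:R^-1 - x t 0 j.
  have e0 : 0 < e by rewrite subr_gt0.
  have N0 : 0 < (N.+1%:R : R) by [].
  have N1 : 1 <= (N.+1%:R : R) by rewrite ler1n.
  have ed0 : 0 < e / (2 * N.+1%:R) by rewrite divr_gt0// mulr_gt0.
  have [m [h1 h2]] := near_min t _ ed0.
  have := hN m I; rewrite /= /u => h3.
  have h4 : N.+1%:R * (phi t (net m) - phi t (x t)) < e / 2.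
    rewrite [ltRHS](_ : _ = N.+1%:R * (e / (2 * N.+1%:R))); last first.
      by move: (N.+1%:R : R) N0 => K K0; field; rewrite gt_eqF.
    by rewrite ltr_pM2l// ltrBlDl.
  have h5 : e / (2 * N.+1%:R) <= e / 2.
    by rewrite ler_pM2l// lef_pV2 ?posrE ?mulr_gt0// ler_peMr.
  have eE : a + N.+1%:R^-1 = x t 0 j + e by rewrite /e; ring.
  have := ltrD (lt_le_trans h2 (lerD (lexx _) h5)) h4.
  by rewrite -addrA -splitr -eE ltNge h3.
Qed.

End ArgminMeasurable.

(** * Continuity and measurability of the terms of the Lagrangian *)

Section Regularity.
Context {R : realType}.

Lemma continuous_addf (T : topologicalType) (f g : T -> R) :
  continuous f -> continuous g -> continuous (fun t => f t + g t).
Proof. by move=> cf cg t; exact: (continuousD (cf t) (cg t)). Qed.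

Lemma continuous_mulf (T : topologicalType) (f g : T -> R) :
  continuous f -> continuous g -> continuous (fun t => f t * g t).
Proof. by move=> cf cg t; exact: (continuousM (cf t) (cg t)). Qed.

Lemma continuous_sumf (T : topologicalType) (I : Type) (s : seq I) (f : I -> T -> R) :
  (forall i, continuous (f i)) -> continuous (fun t => \sum_(i <- s) f i t).
Proof.
move=> cf; apply: (@continuous_big R I _ _ _ (fun z : R * R => add_continuous z)).
by move=> i _; exact: cf.
Qed.

Lemma continuous_coordB m (x : 'rV[R]_m) j :
  continuous (fun y : 'rV[R]_m => (y - x) 0 j).
Proof.
under eq_fun do rewrite !mxE.
by apply: continuous_addf; [exact: coord_continuous|exact: cst_continuous].
Qed.

Lemma continuous_dotB m (a x : 'rV[R]_m) :
  continuous (fun y : 'rV[R]_m => dot a (y - x)).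
Proof.
apply: continuous_sumf => j; apply: continuous_mulf; last exact: continuous_coordB.
exact: cst_continuous.
Qed.

Lemma continuous_sqr_enormB m (x : 'rV[R]_m) :
  continuous (fun y : 'rV[R]_m => enorm (y - x) ^+ 2).
Proof.
under eq_fun do rewrite sqr_enormE.
apply: continuous_sumf => j; under eq_fun do rewrite expr2.
by apply: continuous_mulf; exact: continuous_coordB.
Qed.

Lemma continuous_pos (T : topologicalType) (f : T -> R) :
  continuous f -> continuous (fun t => pos (f t)).
Proof.
by move=> cf t; apply: (@continuous_max _ _ f (fun=> 0)); [exact: cf|exact: cvg_cst].
Qed.

Lemma measurable_pos {d} {T : measurableType d} (f : T -> R) :
  measurable_fun [set: T] f -> measurable_fun [set: T] (fun t => pos (f t)).
Proof. by move=> mf; apply: measurable_maxr => //; exact: measurable_cst. Qed.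

Lemma measurable_dot {d} {T : measurableType d} m (u w : T -> 'rV[R]_m) :
  (forall j, measurable_fun [set: T] (fun t => u t 0 j)) ->
  (forall j, measurable_fun [set: T] (fun t => w t 0 j)) ->
  measurable_fun [set: T] (fun t => dot (u t) (w t)).
Proof.
by move=> mu mw; apply: measurable_sum => j; exact: measurable_funM.
Qed.

Lemma measurable_rVB {d} {T : measurableType d} m (u w : T -> 'rV[R]_m) j :
  measurable_fun [set: T] (fun t => u t 0 j) ->
  measurable_fun [set: T] (fun t => w t 0 j) ->
  measurable_fun [set: T] (fun t => (u t - w t) 0 j).
Proof.
by move=> mu mw; under eq_fun do rewrite !mxE; exact: measurable_funB.
Qed.

Lemma measurable_enorm {d} {T : measurableType d} m (u : T -> 'rV[R]_m) :
  (forall j, measurable_fun [set: T] (fun t => u t 0 j)) ->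
  measurable_fun [set: T] (fun t => enorm (u t)).
Proof.
move=> mu; apply: (@measurableT_comp _ _ _ _ _ _ (@Num.sqrt R)).
  by apply: continuous_measurable_fun; exact: sqrt_continuous.
exact: measurable_dot.
Qed.

End Regularity.

(** * Averages of points and Jensen's inequality *)

Section Averages.
Context {R : realType} {n : nat} (C : set 'rV[R]_n).
Implicit Type y : nat -> 'rV[R]_n.

Lemma convex_average y K :
  (forall u w (t : R), C u -> C w -> 0 <= t <= 1 -> C (t *: u + (1 - t) *: w)) ->
  (forall k, C (y k)) -> (0 < K)%N -> C ((K%:R)^-1 *: \sum_(k < K) y k).
Proof.
move=> cC Cy; case: K => // K _.
elim: K => [|K ih]; first by rewrite big_ord1 invr1 scale1r.
rewrite big_ord_recr/=; set S := \sum_(k < K.+1) _ in ih *.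
have K1 : 0 < (K.+1%:R : R) by rewrite ltr0n.
have K2 : 0 < (K.+2%:R : R) by rewrite ltr0n.
have E : K.+2%:R = K.+1%:R + 1 :> R by rewrite -natr1.
rewrite (_ : _ *: _ = (K.+2%:R^-1) *: y K.+1 + (1 - K.+2%:R^-1) *: (K.+1%:R^-1 *: S)).
  apply: cC => //; rewrite invr_ge0 ltW//= invf_le1// E.
  by rewrite lerDr ltW.
rewrite scalerDr addrC scalerA; congr (_ + _ *: _).
by move: E; move: (K.+2%:R : R) (K.+1%:R : R) K1 K2 => a b b0 a0 ->; field; rewrite !gt_eqF// -?E//; lra.
Qed.

(** A subgradient at the mean supports [h] there, and its linear terms sum to zero. *)
Lemma subgrad_jensen y K (h : 'rV[R]_n -> R) s : (0 < K)%N -> (forall k, C (y k)) ->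
  is_subgrad C h ((K%:R)^-1 *: \sum_(k < K) y k) s ->
  h ((K%:R)^-1 *: \sum_(k < K) y k) <= (K%:R)^-1 * \sum_(k < K) h (y k).
Proof.
move=> K0 Cy; set m := _ *: _ => hs.
have K0' : 0 < (K%:R : R) by rewrite ltr0n.
rewrite mulrC ler_pdivlMr// mulrC.
have dsum : \sum_(k < K) dot s (y k - m) = 0.
  rewrite (_ : \sum_(k < K) dot s (y k - m) = dot s (\sum_(k < K) (y k - m))).
    rewrite sumrB sumr_const card_ord /m -scaler_nat scalerA mulfV ?gt_eqF// scale1r subrr.
    by rewrite /dot big1// => j _; rewrite mxE mulr0.
  rewrite /dot exchange_big/=; apply: eq_bigr => j _.
  by rewrite -mulr_sumr summxE.
have : \sum_(k < K) (h m + dot s (y k - m)) <= \sum_(k < K) h (y k).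
  by apply: ler_sum => k _; exact: hs.
by rewrite big_split/= dsum addr0 sumr_const card_ord -[h m *+ K]mulr_natl.
Qed.

End Averages.

(** * The SLPMM trajectory *)

Section Trajectory.
Context {R : realType} {n p : nat} (C : set 'rV[R]_n).
Context {d : measure_display} {Xi : measurableType d} (mu : probability Xi R).
Context (F : 'rV[R]_n -> Xi -> R) (G : 'rV[R]_n -> Xi -> 'rV[R]_p).
Context (v0 : 'rV[R]_n -> Xi -> 'rV[R]_n) (v : 'I_p -> 'rV[R]_n -> Xi -> 'rV[R]_n).
Context (Rd nu_g kappa_f kappa_g : R) (x0 : 'rV[R]_n).
Context {dO : measure_display} {Omega : measurableType dO} (P : probability Omega R).
Context (xi : nat -> Omega -> Xi).
Context (xs : nat -> Omega -> 'rV[R]_n) (lams : nat -> Omega -> 'rV[R]_p).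
Context (sigma alpha : R).
Hypothesis convC : forall x y (t : R), C x -> C y -> 0 <= t <= 1 ->
  C (t *: x + (1 - t) *: y).
Hypothesis subF : forall x z, C x -> is_subgrad C (fun y => F y z) x (v0 x z).
Hypothesis subG : forall (i : 'I_p) x z, C x ->
  is_subgrad C (fun y => G y z 0 i) x (v i x z).
Hypothesis measF : jmeasurable C F.
Hypothesis measG : forall i : 'I_p, jmeasurable C (fun x z => G x z 0 i).
Hypothesis measv0 : forall j : 'I_n, jmeasurable C (fun x z => v0 x z 0 j).
Hypothesis measv : forall (i : 'I_p) (j : 'I_n), jmeasurable C (fun x z => v i x z 0 j).
Hypothesis diamC : forall x y, C x -> C y -> enorm (x - y) <= Rd.
Hypothesis boundG : forall x z, C x -> enorm (G x z) <= nu_g.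
Hypothesis boundv0 : forall x z, C x -> enorm (v0 x z) <= kappa_f.
Hypothesis boundv : forall (i : 'I_p) x z, C x -> enorm (v i x z) <= kappa_g.
Hypothesis iid : iid_with_law P mu xi.
Hypothesis Cx0 : C x0.
Hypothesis sigma_gt0 : 0 < sigma.
Hypothesis alpha_gt0 : 0 < alpha.
Hypothesis traj : slpmm_traj sigma alpha C F G v0 v x0 xi xs lams.

Lemma traj_in k w : C (xs k w).
Proof. by case: k => [|k]; [rewrite traj.1|case: (traj.2.2.1 k w)]. Qed.

Lemma traj_min k w y : C y ->
  Lsig sigma F G v0 v (xs k w) (xi k w) (xs k.+1 w) (lams k w)
    + alpha / 2 * enorm (xs k.+1 w - xs k w) ^+ 2
  <= Lsig sigma F G v0 v (xs k w) (xi k w) y (lams k w)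
    + alpha / 2 * enorm (y - xs k w) ^+ 2.
Proof. by case: (traj.2.2.1 k w) => _; exact. Qed.

Lemma lams0 w : lams 0 w = 0. Proof. exact: traj.2.1. Qed.

Lemma lamsS k w i : lams k.+1 w 0 i =
  pos (lams k w 0 i + sigma * (G (xs k w) (xi k w) 0 i
         + dot (v i (xs k w) (xi k w)) (xs k.+1 w - xs k w))).
Proof. exact: traj.2.2.2. Qed.

Lemma lams_ge0 k w i : 0 <= lams k w 0 i.
Proof. by case: k => [|k]; [rewrite lams0 mxE|rewrite lamsS pos_ge0]. Qed.

Lemma enorm_lams0 w : enorm (lams 0 w) = 0.
Proof.
by rewrite lams0 /enorm /dot big1 ?sqrtr0// => j _; rewrite mxE mul0r.
Qed.

Let D := sigma * beta0 p nu_g kappa_g Rd.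

Lemma enorm_lams_step k w : `|enorm (lams k.+1 w) - enorm (lams k w)| <= D.
Proof.
exact: (multiplier_increment diamC boundG boundv sigma_gt0 (traj_in k w)
  (traj_in k.+1 w) (lams_ge0 k w) (lamsS k w)).
Qed.

Lemma enorm_lams_dist k t w :
  `|enorm (lams (k + t)%N w) - enorm (lams k w)| <= t%:R * D.
Proof.
elim: t => [|t ih]; first by rewrite addn0 subrr normr0 mul0r.
rewrite addnS -(subrKA (enorm (lams (k + t)%N w))) -natr1 mulrDl mul1r [leRHS]addrC.
apply: (le_trans (ler_normD _ _)); apply: lerD => //.
exact: enorm_lams_step.
Qed.

Lemma enorm_lams_le k w : enorm (lams k w) <= k%:R * D.
Proof.
have := enorm_lams_dist 0 k w; rewrite add0n enorm_lams0 subr0.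
by rewrite ger0_norm ?enorm_ge0.
Qed.

Lemma measurable_Lsig {d'} {T : measurableType d'} (X Y : T -> 'rV[R]_n)
    (Z : T -> Xi) (l : T -> 'rV[R]_p) :
  (forall t, C (X t)) ->
  (forall j, measurable_fun [set: T] (fun t => X t 0 j)) ->
  (forall j, measurable_fun [set: T] (fun t => Y t 0 j)) ->
  measurable_fun [set: T] Z ->
  (forall i, measurable_fun [set: T] (fun t => l t 0 i)) ->
  measurable_fun [set: T] (fun t => Lsig sigma F G v0 v (X t) (Z t) (Y t) (l t)).
Proof.
move=> CX mX mY mZ ml; have mYX j := measurable_rVB (mY j) (mX j).
apply: measurable_funD; first apply: measurable_funD.
- exact: measF.
- by apply: measurable_dot => // j; exact: measv0.
- apply: measurable_funM; first exact: measurable_cst.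
  apply: measurable_funB; last by apply: measurable_funX; exact: measurable_enorm.
  apply: measurable_sum => i; apply: measurable_funX; apply: measurable_pos.
  apply: measurable_funD => //; apply: measurable_funM; first exact: measurable_cst.
  apply: measurable_funD; first exact: measG.
  by apply: measurable_dot => // j; exact: measv.
Qed.

Lemma continuous_Lsig x z l : continuous (fun y => Lsig sigma F G v0 v x z y l).
Proof.
have cc (a : R) : continuous (fun y : 'rV[R]_n => a) by exact: cst_continuous.
apply: continuous_addf; first by apply: continuous_addf => //; exact: continuous_dotB.
apply: continuous_mulf => //; apply: continuous_addf => //.
apply: continuous_sumf => i; under eq_fun do rewrite expr2.
have h : continuous (fun y : 'rV[R]_n => pos (l 0 i + sigma * (G x z 0 i + dot (v i x z) (y - x)))).
  apply: continuous_pos; apply: continuous_addf => //.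
  apply: continuous_mulf => //; apply: continuous_addf => //.
  exact: continuous_dotB.
exact: continuous_mulf.
Qed.

(** Iterate [k] uses only samples of index below [k], so [xi k] is still fresh at that time. *)
Lemma traj_adapted k :
  (forall j, measurable_fun [set: past xi k] (fun w => xs k w 0 j)) /\
  (forall i, measurable_fun [set: past xi k] (fun w => lams k w 0 i)).
Proof.
elim: k => [|k [ihx ihl]].
  split => j; [under eq_fun do rewrite traj.1|under eq_fun do rewrite lams0];
    exact: measurable_cst.
have mx j : measurable_fun [set: past xi k.+1] (fun w => xs k w 0 j).
  exact: measurable_past_le (leqnSn k) (ihx j).
have ml i : measurable_fun [set: past xi k.+1] (fun w => lams k w 0 i).
  exact: measurable_past_le (leqnSn k) (ihl i).
have mxi := @measurable_past_sample d dO Xi Omega xi k.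
have mx' j : measurable_fun [set: past xi k.+1] (fun w => xs k.+1 w 0 j).
  apply: (@measurable_rV_argmin R n C _ (past xi k.+1) (fun w y =>
    Lsig sigma F G v0 v (xs k w) (xi k w) y (lams k w)
    + alpha / 2 * enorm (y - xs k w) ^+ 2) (alpha / 2) (xs k.+1)).
  - exact: divr_gt0.
  - by move=> w; exact: traj_in.
  - move=> w; apply: continuous_addf; first exact: continuous_Lsig.
    apply: continuous_mulf; last exact: continuous_sqr_enormB.
    exact: cst_continuous.
  - move=> y; apply: measurable_funD.
      by apply: measurable_Lsig => // *; exact: traj_in.
    apply: measurable_funM; first exact: measurable_cst.
    apply: measurable_funX; by apply: measurable_enorm => i; apply: measurable_rVB.
  - move=> w y Cy; exact: (prox_three_point convC sigma_gt0 alpha_gt0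
      (traj_in k.+1 w) (traj_min k w)).
split => // i; under eq_fun do rewrite lamsS.
apply: measurable_pos; apply: measurable_funD => //.
apply: measurable_funM; first exact: measurable_cst.
apply: measurable_funD; first by apply: measG => // w; exact: traj_in.
apply: measurable_dot => j; last exact: measurable_rVB.
by apply: measv => // w; exact: traj_in.
Qed.

(** The bound grows with [k] and serves integrability only; the uniform bound comes from the
    drift. *)
Lemma bmfun_lams k i : @bmfun R _ (past xi k) (fun w => lams k w 0 i).
Proof.
split; first exact: (traj_adapted k).2.
by exists (k%:R * D) => w; rewrite (le_trans (normr_coord_le _ _))// enorm_lams_le.
Qed.

Lemma bmfun_enorm_lams k : @bmfun R _ (past xi k) (fun w => enorm (lams k w)).
Proof.
split; first by apply: measurable_enorm; exact: (traj_adapted k).2.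
by exists (k%:R * D) => w; rewrite ger0_norm ?enorm_ge0// enorm_lams_le.
Qed.

(** Applied to the coordinates of [G] and to [F x z - F xstar z]; no bound is assumed on [F]
    itself. *)
Definition bounded_field (H : 'rV[R]_n -> Xi -> R) :=
  jmeasurable C H /\ exists M, forall x z, C x -> `|H x z| <= M.

Lemma bounded_field_G i : bounded_field (fun x z => G x z 0 i).
Proof.
split; first exact: measG.
by exists nu_g => x z Cx; rewrite (le_trans (normr_coord_le _ _))// boundG.
Qed.

Lemma bmfun_field {d'} {T : measurableType d'} (X : T -> 'rV[R]_n) H :
  bounded_field H -> (forall t, C (X t)) ->
  (forall j, measurable_fun [set: T] (fun t => X t 0 j)) ->
  bmfun (fun t : T * Xi => H (X t.1) t.2).
Proof.
move=> [mH [M HM]] CX mX; split; last by exists M => t; exact: HM.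
apply: (mH _ (T * Xi)%type (fun t => X t.1) snd) => // j.
exact: (measurableT_comp (mX j) measurable_fst).
Qed.

Lemma bmfun_field_at H x : bounded_field H -> C x -> bmfun (H x).
Proof.
move=> bH Cx; apply: (@bmfun_section R _ _ Xi Xi (fun=> H x) point).
by apply: (bmfun_field (X := fun=> x) bH) => // j; exact: measurable_cst.
Qed.

Lemma expect_along_traj H k : bounded_field H ->
  \int[P]_w H (xs k w) (xi k w) = \int[P]_w expect mu H (xs k w).
Proof.
move=> bH; rewrite (Rintegral_past iid (h := fun w z => H (xs k w) z))//.
apply: (bmfun_field bH); first by move=> w; exact: traj_in.
exact: (traj_adapted k).1.
Qed.

Lemma bmfun_expect_traj H k : bounded_field H ->
  @bmfun R _ (past xi k) (fun w => expect mu H (xs k w)).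
Proof.
move=> bH; apply: (@bmfun_Rintegral R _ _ (past xi k) Xi mu).
apply: (bmfun_field bH); first by move=> w; exact: traj_in.
exact: (traj_adapted k).1.
Qed.

Lemma bmfun_traj H k : bounded_field H ->
  @bmfun R _ (past xi k.+1) (fun w => H (xs k w) (xi k w)).
Proof.
move=> bH; have := bH => -[mH [M HM]]; split; last first.
  by exists M => w; apply: HM; exact: traj_in.
apply: (mH _ (past xi k.+1)) => [w|j|]; first exact: traj_in.
- exact: measurable_past_le (leqnSn k) ((traj_adapted k).1 j).
- exact: measurable_past_sample.
Qed.

Lemma bmfun_sample (h : Xi -> R) k : bmfun h ->
  @bmfun R _ (past xi k.+1) (fun w => h (xi k w)).
Proof.
move=> [mh [M hM]]; split; last by exists M.
exact: (measurableT_comp mh (@measurable_past_sample _ _ _ _ xi k)).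
Qed.

(** The martingale difference property, stated with a past-measurable weight [U] in place of
    conditioning. *)
Lemma centered_sample (U : Omega -> R) (h : Xi -> R) k : bmfun h ->
  @bmfun R _ (past xi k) U ->
  \int[P]_w (U w * (h (xi k w) - \int[mu]_z h z)) = 0.
Proof.
move=> bh bU; pose m := \int[mu]_z h z.
have bhm : bmfun (fun z => h z - m) by apply: bmfunB => //; exact: bmfun_cst.
rewrite (Rintegral_past iid (h := fun w z => U w * (h z - m))); last first.
  apply: bmfunM.
    have [mU [M hM]] := bU; split; last by exists M.
    exact: (measurableT_comp mU measurable_fst).
  have [mh [M hM]] := bhm; split; last by exists M.
  exact: (measurableT_comp mh measurable_snd).
have E w : \int[mu]_z (U w * (h z - m)) = 0.
  rewrite RintZ// RintB//; last exact: bmfun_cst.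
  by rewrite Rint_cst subrr mulr0.
by under eq_Rintegral do rewrite E; rewrite Rint_cst.
Qed.

Let Z k w := enorm (lams k w).

Let noise y k w := \sum_(i < p) lams k w 0 i *
  (G y (xi k w) 0 i - expect mu (fun x z => G x z 0 i) y).

Lemma bmfun_G_at y i : C y -> bmfun (fun z => G y z 0 i).
Proof. by move=> Cy; exact: (bmfun_field_at (bounded_field_G i) Cy). Qed.

Lemma bmfun_noise y k : C y -> @bmfun R _ (past xi k.+1) (noise y k).
Proof.
move=> Cy; apply: bmfun_sum => i; apply: bmfunM.
  exact: bmfun_past_le (leqnSn k) (bmfun_lams k i).
apply: bmfunB; last exact: bmfun_cst.
by apply: (bmfun_sample (h := fun z => G y z 0 i)); exact: bmfun_G_at.
Qed.

Lemma noise_centered (U : Omega -> R) y k : C y -> @bmfun R _ (past xi k) U ->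
  \int[P]_w (U w * noise y k w) = 0.
Proof.
move=> Cy bU; under eq_Rintegral do rewrite mulr_sumr.
have bUl i : @bmfun R _ (past xi k) (fun w => U w * lams k w 0 i).
  by apply: bmfunM => //; exact: bmfun_lams.
rewrite Rint_sum => [|i].
  rewrite big1// => i _; under eq_Rintegral do rewrite mulrA.
  exact: (centered_sample (h := fun z => G y z 0 i) (bmfun_G_at i Cy) (bUl i)).
apply: (bmfun_past iid (k := k.+1)).
under eq_fun do rewrite mulrA.
apply: bmfunM; first exact: bmfun_past_le (leqnSn k) (bUl i).
apply: bmfunB; last exact: bmfun_cst.
by apply: (bmfun_sample (h := fun z => G y z 0 i)); exact: bmfun_G_at.
Qed.

Lemma dot_lams_noise y k w : dot (lams k w) (G y (xi k w)) =
  noise y k w + \sum_(i < p) lams k w 0 i * expect mu (fun x z => G x z 0 i) y.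
Proof.
by rewrite -big_split; apply: eq_bigr => i _ /=; rewrite -mulrDr subrK.
Qed.

(** * Drift of the multipliers *)

Section Slater.
Context (eps0 : R) (xhat : 'rV[R]_n).
Hypothesis eps0_gt0 : 0 < eps0.
Hypothesis Cxhat : C xhat.
Hypothesis slater : forall i : 'I_p, expect mu (fun x z => G x z 0 i) xhat <= - eps0.

Let a k w := enorm (xhat - xs k w) ^+ 2.

(** At the Slater point the mean constraints contribute at most [- eps0] times the sum of the
    multipliers, and for nonnegative vectors that sum dominates the norm. *)
Lemma sqr_lams_step k w : Z k.+1 w ^+ 2 - Z k w ^+ 2 <=
  2 * sigma * (kappa_f * Rd + sigma / 2 * nu_g ^+ 2 + noise xhat k w - eps0 * Z k w
    + alpha / 2 * (a k w - a k.+1 w)).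
Proof.
have s0 := sigma_gt0.
have := prox_drift_bound convC subG diamC boundG boundv0 sigma_gt0 alpha_gt0
  (traj_in k w) (traj_in k.+1 w) (traj_min k w) (lamsS k w) Cxhat.
move=> /le_trans; apply; rewrite ler_pM2l ?mulr_gt0// -/(a k w) -/(a k.+1 w).
rewrite dot_lams_noise.
have : \sum_(i < p) lams k w 0 i * expect mu (fun x z => G x z 0 i) xhat
    <= - eps0 * \sum_(i < p) lams k w 0 i.
  rewrite mulr_sumr; apply: ler_sum => i _; rewrite [leRHS]mulrC.
  by rewrite ler_wpM2l ?lams_ge0.
have : eps0 * Z k w <= eps0 * \sum_(i < p) lams k w 0 i.
  by rewrite ler_pM2l//; apply: enorm_le_sum => i; exact: lams_ge0.
lra.
Qed.

(** Each [Z (k + j)] is replaced by [Z k - j * D]; summing [j] over the window gives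
    [t * (t - 1) / 2], and the distances to [xhat] telescope. *)
Lemma sqr_lams_window k t w : Z (k + t) w ^+ 2 <= Z k w ^+ 2 +
  2 * sigma * (t%:R * (kappa_f * Rd + sigma / 2 * nu_g ^+ 2)
    + \sum_(j < t) noise xhat (k + j) w - eps0 * (t%:R * Z k w)
    + eps0 * D * (t%:R * (t%:R - 1) / 2)
    + alpha / 2 * (a k w - a (k + t) w)).
Proof.
elim: t => [|t ih].
  by rewrite addn0 big_ord0 subrr !mul0r !mulr0 subr0 !addr0 mulr0 addr0.
have := sqr_lams_step (k + t) w; rewrite -addnS => st.
have := enorm_lams_dist k t w; rewrite ler_norml -/(Z _ w) -/(Z k w) => /andP[+ _].
have s0 := sigma_gt0; have e0 := eps0_gt0; rewrite -(ler_pM2l e0) => hd.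
have hs := ler_wpM2l (mulr_ge0 (ler0n R 2) (ltW s0)) hd.
have T1 : t.+1%:R = t%:R + 1 :> R by rewrite -natr1.
rewrite big_ord_recr/= T1; lra.
Qed.


(** The index [i0] provides a constraint, from which [eps0 <= nu_g] and [0 <= kappa_g] follow; [t0]
    is the window length. *)
Context (i0 : 'I_p) (t0 : nat).
Hypothesis t0_gt0 : (0 < t0)%N.
Hypothesis alpha_t0 : alpha <= t0%:R.

Let b := beta0 p nu_g kappa_g Rd.
Let tau := sigma * t0%:R.
(** Above [theta], half of the descent [2 * tau * eps0 * Z] pays for the other terms and the rest is
    [2 * margin * Z]. So [theta] is that cost plus [margin]; the [- beta0] in [kappa2] reflects
    [t * (t - 1)] instead of [t ^+ 2]. *)
Let margin := tau * eps0 / 2.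
Let theta := kappa0 kappa_f Rd eps0 + kappa1 Rd eps0
  + kappa2 p nu_g kappa_g Rd eps0 * sigma + tau * (b + eps0 / 2).

Lemma Rd_ge0 : 0 <= Rd.
Proof. by rewrite (le_trans _ (diamC Cx0 Cx0))// enorm_ge0. Qed.

Lemma eps0_le_nu_g : eps0 <= nu_g.
Proof.
have := slater i0; have : `|expect mu (fun x z => G x z 0 i0) xhat| <= nu_g.
  apply: Rint_norm_le; first exact: bmfun_G_at.
  by move=> z; rewrite (le_trans (normr_coord_le _ _))// boundG.
by rewrite ler_norml; lra.
Qed.

Lemma nu_g_le_beta0 : nu_g <= b.
Proof.
rewrite /b /beta0 lerDl mulr_ge0 ?Rd_ge0// mulr_ge0 ?sqrtr_ge0//.
by rewrite (le_trans _ (boundv i0 point Cx0))// enorm_ge0.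
Qed.

Lemma t0R_ge1 : 1 <= t0%:R :> R. Proof. by rewrite ler1n. Qed.

Lemma thetaE : eps0 * t0%:R * theta = 2 * kappa_f * Rd * t0%:R + Rd ^+ 2 * t0%:R
  + sigma * nu_g ^+ 2 * t0%:R - eps0 * b * tau
  + eps0 * tau * t0%:R * (b + eps0 / 2).
Proof.
rewrite /theta /kappa0 /kappa1 /kappa2 -/b /tau.
by move: (t0%:R : R) => T; field; rewrite gt_eqF.
Qed.

Lemma kappa_f_ge0 : 0 <= kappa_f.
Proof. by rewrite (le_trans _ (boundv0 point Cx0))// enorm_ge0. Qed.

(** Makes [Z k - margin] positive above the threshold, so it can be divided by. The negative part of
    [kappa2 * sigma] is covered by [tau * b] since [t0 >= 1]. *)
Lemma theta_gt_margin : margin < theta.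
Proof.
have e0 := eps0_gt0; have s0 := sigma_gt0; have t1 := t0R_ge1.
have nu0 : 0 < nu_g by exact: lt_le_trans e0 eps0_le_nu_g.
have b0 : 0 < b by exact: lt_le_trans nu0 nu_g_le_beta0.
have t00 : 0 < t0%:R :> R by rewrite ltr0n.
rewrite -(ltr_pM2l (mulr_gt0 e0 t00)) thetaE /margin.
have h1 : 0 <= 2 * kappa_f * Rd * t0%:R.
  by rewrite !mulr_ge0 ?Rd_ge0 ?kappa_f_ge0// ltW.
have h2 : 0 <= Rd ^+ 2 * t0%:R by rewrite mulr_ge0 ?sqr_ge0// ltW.
have h3 : 0 < sigma * nu_g ^+ 2 * t0%:R by rewrite !mulr_gt0 ?exprn_gt0.
have tau0 : 0 < tau by rewrite mulr_gt0.
have h4 : 0 <= eps0 * tau * b * (t0%:R - 1).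
  by rewrite !mulr_ge0 ?subr_ge0// ltW.
move: (t0%:R : R) h1 h2 h3 h4 => T; lra.
Qed.

(** The centered, martingale part of a window; the descent itself is carried by [margin]. *)
Let drift k w := \sum_(j < t0) noise xhat (k + j) w.

(* Above [theta] the squared norm drops below [(Z k - margin) ^ 2] up to the
   martingale term, and AM-GM linearizes the square root. *)
Lemma lams_window k w : theta <= Z k w ->
  Z (k + t0) w <= (Z k w - margin) + sigma / (Z k w - margin) * drift k w.
Proof.
move=> hZ; have e0 := eps0_gt0; have s0 := sigma_gt0.
have t00 : 0 < t0%:R :> R by rewrite ltr0n.
have c0 : 0 < Z k w - margin.
  by rewrite subr_gt0; exact: lt_le_trans theta_gt_margin hZ.
have hs : Z (k + t0) w ^+ 2 <= (Z k w - margin) ^+ 2 + 2 * sigma * drift k w.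
  apply: (le_trans (sqr_lams_window k t0 w)).
  have := hZ; rewrite -(ler_pM2l (mulr_gt0 e0 t00)) thetaE => h.
  have h1 : a k w <= Rd ^+ 2.
    by rewrite /a ler_pXn2r ?nnegrE ?Rd_ge0 ?enorm_ge0 ?diamC//; exact: traj_in.
  have h2 : 0 <= a (k + t0) w by exact: sqr_ge0.
  have h3 : alpha * (a k w - a (k + t0) w) <= t0%:R * Rd ^+ 2.
    apply: (@le_trans _ _ (alpha * Rd ^+ 2)).
      by rewrite ler_pM2l//; lra.
    by rewrite ler_wpM2r ?sqr_ge0.
  have h4 : 0 <= eps0 * tau * t0%:R * eps0.
    by rewrite !mulr_ge0// ?ltW// mulr_gt0.
  rewrite -/(drift k w) /D -/b.
  set dr := drift k w; set A1 := a k w in h3 *; set A2 := a (k + t0) w in h3 *.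
  set Y := Z k w in h *.
  have main : t0%:R * (kappa_f * Rd + sigma / 2 * nu_g ^+ 2) - eps0 * (t0%:R * Y)
      + eps0 * (sigma * b) * (t0%:R * (t0%:R - 1) / 2) + alpha / 2 * (A1 - A2)
      <= - (t0%:R * eps0 / 2) * Y.
    by move: h3 h h4; rewrite /tau; move: (t0%:R : R) => T; lra.
  have := ler_wpM2l (mulr_ge0 (ler0n R 2) (ltW s0)) main.
  have := sqr_ge0 margin; rewrite /margin /tau.
  by move: (t0%:R : R) => T; lra.
rewrite -(ler_pM2l c0).
rewrite [leRHS](_ : _ = (Z k w - margin) ^+ 2 + sigma * drift k w); last first.
  by move: (Z k w - margin) c0 => c c0; field; rewrite gt_eqF.
by have := sqr_ge0 (Z (k + t0) w - (Z k w - margin)); lra.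
Qed.

(* [rate] minimizes [- rate * margin + 2 * (rate * (t0%:R * D)) ^+ 2], and [rho - 1]
   is the minimum. *)
Let rate := eps0 / (8 * (tau * b ^+ 2)).
Let rho := 1 - eps0 ^+ 2 / (32 * b ^+ 2).
Let V k w := expR (rate * Z k w).
(* [expR (- ln c)] is [c^-1], written so that its measurability is immediate. *)
Let U k w := if theta <= Z k w then
  V k w * (rate * sigma * expR (- ln (Z k w - margin))) else 0.

Lemma b_gt0 : 0 < b.
Proof.
exact: lt_le_trans (lt_le_trans eps0_gt0 eps0_le_nu_g) nu_g_le_beta0.
Qed.

Lemma eps0_le_b : eps0 <= b.
Proof. exact: le_trans eps0_le_nu_g nu_g_le_beta0. Qed.

Lemma tau_gt0 : 0 < tau.
Proof. by rewrite mulr_gt0// ltr0n. Qed.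

Lemma rate_gt0 : 0 < rate.
Proof. by rewrite divr_gt0// mulr_gt0// mulr_gt0 ?tau_gt0// exprn_gt0// b_gt0. Qed.

(** [expR x <= 1 / (1 - x)], and [(1 + x + 2 * x ^+ 2) * (1 - x) = 1 + x ^+ 2 * (1 - 2 * x)]. *)
Lemma expR_le_quadratic (x : R) : x <= 1 / 2 -> expR x <= 1 + x + 2 * x ^+ 2.
Proof.
move=> x2; have x1 : 0 < 1 - x by lra.
have h : 1 - x <= expR (- x) by have := expR_ge1Dx (- x); lra.
have : expR x <= (1 - x)^-1.
  by rewrite -[expR x]invrK -expRN lef_pV2 ?posrE ?expR_gt0.
move=> /le_trans; apply; rewrite -[X in X <= _]mul1r ler_pdivrMr//.
have := mulr_ge0 (sqr_ge0 x) (_ : 0 <= 1 - 2 * x); lra.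
Qed.

Lemma rate_tD : rate * (t0%:R * D) = eps0 / (8 * b).
Proof.
rewrite /rate /D -/b /tau; have b0 := b_gt0.
have t00 : 0 < t0%:R :> R by rewrite ltr0n.
by move: (t0%:R : R) t00 => T T0; field; rewrite !gt_eqF.
Qed.

Lemma rho_ge0 : 0 <= rho.
Proof.
have b0 := b_gt0; have e0 := eps0_gt0; have eb := eps0_le_b.
rewrite subr_ge0 ler_pdivrMr ?mulr_gt0 ?exprn_gt0// mul1r.
have : eps0 ^+ 2 <= b ^+ 2 by rewrite ler_pXn2r// nnegrE ltW.
have := sqr_ge0 b; lra.
Qed.

(** Below [theta] bounded increments give the constant and [U] is zero. Above it, the exponential of
    the small increment is expanded to second order and [lams_window] bounds the linear part. *)
Lemma exp_window k w : V (k + t0) w <=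
  rho * V k w + expR (rate * (theta + t0%:R * D)) + U k w * drift k w.
Proof.
have r0 := rate_gt0; have b0 := b_gt0; have e0 := eps0_gt0; have s0 := sigma_gt0.
have V0 : 0 < V k w by exact: expR_gt0.
have := enorm_lams_dist k t0 w; rewrite -/(Z _ w) -/(Z k w) => hD.
rewrite /U; case: (leP theta (Z k w)) => hZ; last first.
  rewrite mul0r addr0 -[V (k + t0) w]add0r lerD//.
    by rewrite mulr_ge0 ?rho_ge0// ltW.
  rewrite ler_expR ler_pM2l//; move: hD; rewrite ler_norml; lra.
have c0 : 0 < Z k w - margin.
  by rewrite subr_gt0; exact: lt_le_trans theta_gt_margin hZ.
pose x := rate * (Z (k + t0) w - Z k w).
have -> : V (k + t0) w = V k w * expR x.
  by rewrite /V -expRD; congr expR; rewrite /x; ring.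
have xn : `|x| <= eps0 / (8 * b).
  by rewrite /x normrM (gtr0_norm r0) -rate_tD ler_pM2l.
have eb1 : eps0 / (8 * b) <= 1 / 2.
  rewrite ler_pdivrMr ?mulr_gt0//; have := eps0_le_b; lra.
have hx : expR x <= 1 + x + 2 * x ^+ 2.
  by apply: expR_le_quadratic; move: xn; rewrite ler_norml; lra.
have x2 : x ^+ 2 <= (eps0 / (8 * b)) ^+ 2.
  by rewrite -(real_normK (num_real x)) ler_pXn2r ?nnegrE// (le_trans _ xn).
have hwin := lams_window hZ.
have x1 : x <= rate * (- margin + sigma / (Z k w - margin) * drift k w).
  by rewrite /x ler_pM2l//; lra.
have rm : rate * margin = eps0 ^+ 2 / (16 * b ^+ 2).
  rewrite /rate /margin; have := tau_gt0; move: tau => u u0.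
  by field; rewrite !gt_eqF.
have x2E : (eps0 / (8 * b)) ^+ 2 = eps0 ^+ 2 / (64 * b ^+ 2).
  by field; rewrite gt_eqF.
have h : expR x <= rho + rate * sigma * (Z k w - margin)^-1 * drift k w.
  (* In units of [1 - rho], the linear term gains 2 and the quadratic term costs at most 1. *)
  have q1 : eps0 ^+ 2 / (16 * b ^+ 2) = 2 * (eps0 ^+ 2 / (32 * b ^+ 2)).
    by field; rewrite gt_eqF.
  have q2 : eps0 ^+ 2 / (64 * b ^+ 2) = (eps0 ^+ 2 / (32 * b ^+ 2)) / 2.
    by field; rewrite gt_eqF.
  rewrite /rho; move: x1; rewrite mulrDr mulrN rm q1.
  rewrite x2E q2 in x2.
  rewrite [rate * (sigma / _ * _)]mulrA [rate * (sigma / _)]mulrA => x1.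
  move: (_ / (32 * _)) (_ * drift k w) x1 x2 hx => Q W; lra.
have := ler_wpM2l (ltW V0) h.
rewrite expRN lnK ?posrE//.
have := expR_gt0 (rate * (theta + t0%:R * D)).
move: (rate * sigma * _) (drift k w) (expR (_ * (_ + _))) => W1 W2 W3; lra.
Qed.

Lemma bmfun_V k : @bmfun R _ (past xi k) (V k).
Proof.
split.
  apply: (measurableT_comp (@measurable_expR R)); apply: measurable_funM.
    exact: measurable_cst.
  exact: (bmfun_enorm_lams k).1.
exists (expR (rate * (k%:R * D))) => w.
by rewrite gtr0_norm ?expR_gt0// ler_expR ler_pM2l ?rate_gt0 ?enorm_lams_le.
Qed.

Lemma bmfun_U k : @bmfun R _ (past xi k) (U k).
Proof.
have mZ : measurable_fun [set: past xi k] (Z k) := (bmfun_enorm_lams k).1.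
split.
  apply: (@measurable_fun_ifT _ _ (past xi k) R).
  - by apply: measurable_fun_ler => //; exact: measurable_cst.
  - apply: measurable_funM; first exact: (bmfun_V k).1.
    apply: measurable_funM; first exact: measurable_cst.
    apply: (measurableT_comp (@measurable_expR R)); apply: measurable_funN.
    apply: (measurableT_comp (@measurable_ln R)).
    by apply: measurable_funB => //; exact: measurable_cst.
  - exact: measurable_cst.
have c0 : 0 < theta - margin by rewrite subr_gt0 theta_gt_margin.
have [_ [M HM]] := bmfun_V k.
have rs : 0 <= rate * sigma by rewrite mulr_ge0// ltW// rate_gt0.
have M0 : 0 <= M by exact: le_trans (HM point).
exists (M * (rate * sigma * (theta - margin)^-1)) => w; rewrite /U.
case: (leP theta (Z k w)) => hZ; last first.
  by rewrite normr0 mulr_ge0// (mulr_ge0 rs)// invr_ge0 ltW.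
have cw : 0 < Z k w - margin by rewrite (lt_le_trans c0)// lerB.
rewrite normrM expRN lnK ?posrE//; apply: ler_pM => //.
rewrite ger0_norm; last by rewrite mulr_ge0// invr_ge0 ltW.
by apply: ler_wpM2l => //; rewrite lef_pV2 ?posrE// lerB.
Qed.

Lemma drift_centered k : \int[P]_w (U k w * drift k w) = 0.
Proof.
have bUn (j : 'I_t0) : @bmfun R _ (past xi (k + j).+1) (fun w => U k w * noise xhat (k + j) w).
  apply: bmfunM; last exact: bmfun_noise.
  by apply: bmfun_past_le (bmfun_U k); rewrite -addnS leq_addr.
under eq_Rintegral do rewrite mulr_sumr.
rewrite Rint_sum => [|j]; last exact: bmfun_past iid _ _ (bUn j).
rewrite big1// => j _; apply: noise_centered => //.
by apply: bmfun_past_le (bmfun_U k); exact: leq_addr.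
Qed.

(** Induction in strides of [t0]: [q = 1 / (1 - rho)], so [B0 * q] is the fixed point of the
    recursion [v = rho * v + B0]. *)
Lemma exp_moment k : \int[P]_w V k w <=
  expR (rate * (theta + t0%:R * D)) * (32 * b ^+ 2 / eps0 ^+ 2).
Proof.
have r0 := rate_gt0; have b0 := b_gt0; have e0 := eps0_gt0; have s0 := sigma_gt0.
set B0 := expR _; set q := 32 * b ^+ 2 / eps0 ^+ 2.
have B00 : 0 < B0 by exact: expR_gt0.
have D0 : 0 < D by rewrite mulr_gt0.
have bV l : bmfun (V l) by exact: bmfun_past iid _ _ (bmfun_V l).
have theta0 : 0 <= theta.
  rewrite ltW// (le_lt_trans _ theta_gt_margin)// /margin.
  by rewrite divr_ge0// mulr_ge0// ltW// tau_gt0.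
have q1 : 1 <= q.
  rewrite ler_pdivlMr ?exprn_gt0// mul1r.
  have : eps0 ^+ 2 <= b ^+ 2 by rewrite ler_pXn2r ?nnegrE ?eps0_le_b// ltW.
  have := sqr_ge0 b; lra.
elim/ltn_ind: k => k ih; case: (ltnP k t0) => kt0.
  apply: (@le_trans _ _ B0); last by rewrite ler_peMr// ltW.
  rewrite -(Rint_cst P B0); apply: Rint_le => //; first exact: bmfun_cst.
  move=> w; rewrite ler_expR ler_pM2l//.
  apply: (le_trans (enorm_lams_le k w)); rewrite (@le_trans _ _ (t0%:R * D))//.
    by rewrite ler_pM2r// ler_nat ltnW.
  by rewrite lerDr.
have := ih (k - t0)%N; rewrite ltn_subrL t0_gt0 (leq_trans t0_gt0 kt0) => /(_ isT) ihk.
rewrite -{1}(subnK kt0); set l := (k - t0)%N in ihk *.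
have bUd : bmfun (fun w => U l w * drift l w).
  apply: bmfunM; first exact: bmfun_past iid _ _ (bmfun_U l).
  by apply: bmfun_sum => j; exact: bmfun_past iid _ _ (bmfun_noise _ Cxhat).
have bc : bmfun (fun w => rho * V l w + B0).
  by apply: bmfunD; [exact: bmfunZ|exact: bmfun_cst].
apply: (@le_trans _ _ (\int[P]_w (rho * V l w + B0 + U l w * drift l w))).
  apply: Rint_le => //; first exact: bmfunD.
  by move=> w; exact: exp_window.
rewrite RintD// drift_centered addr0 RintD//; [|exact: bmfunZ|exact: bmfun_cst].
rewrite RintZ// Rint_cst.
have := ler_wpM2l rho_ge0 ihk.
have : (1 - rho) * q = 1.
  by rewrite /rho /q; field; rewrite !gt_eqF.
move=> hq; have : B0 * ((1 - rho) * q) = B0 by rewrite hq mulr1.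
lra.
Qed.

Lemma mean_multiplier k : \int[P]_w Z k w <= theta + t0%:R * D
  + 8 * (tau * b ^+ 2) / eps0 * ln (32 * b ^+ 2 / eps0 ^+ 2).
Proof.
have r0 := rate_gt0; have b0 := b_gt0; have e0 := eps0_gt0.
set q := 32 * b ^+ 2 / eps0 ^+ 2.
have q0 : 0 < q by rewrite divr_gt0 ?mulr_gt0// exprn_gt0.
(* The logarithm of the moment bound. Jensen is replaced by the tangent line of the exponential at
   [c], where [expR (- c)] times the moment is at most 1. *)
pose c := rate * (theta + t0%:R * D) + ln q.
have bV : bmfun (V k) by exact: bmfun_past iid _ _ (bmfun_V k).
have bZ : bmfun (Z k) by exact: bmfun_past iid _ _ (bmfun_enorm_lams k).
have h : \int[P]_w (1 - c + rate * Z k w) <= \int[P]_w (expR (- c) * V k w).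
  apply: Rint_le.
  - by apply: bmfunD; [exact: bmfun_cst|exact: bmfunZ].
  - exact: bmfunZ.
  - by move=> w; rewrite -expRD; have := expR_ge1Dx (- c + rate * Z k w); lra.
move: h; rewrite RintD; [|exact: bmfun_cst|exact: bmfunZ].
rewrite Rint_cst !RintZ// => h.
have h2 : expR (- c) * \int[P]_w V k w <= 1.
  have := ler_wpM2l (ltW (expR_gt0 (- c))) (exp_moment k).
  by rewrite -/q -[X in _ * (_ * X)]lnK ?posrE// -expRD -/c -expRD addNr expR0.
rewrite -(ler_pM2l r0).
rewrite [leRHS](_ : _ = c); first by move: h h2; lra.
rewrite /c mulrDr; congr (_ + _).
rewrite /rate; have := tau_gt0; move: tau (ln q) => u lq u0.
by field; rewrite !gt_eqF.
Qed.

(** The terms proportional to [tau] add up to [tau * kappa3], and [kappa3 >= 0]; hence the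
    [2 * kappa3] in [kappabar]. *)
Lemma mean_multiplier_kappabar k : tau <= 2 -> \int[P]_w Z k w <=
  kappabar p kappa_f nu_g kappa_g Rd eps0 + kappa2 p nu_g kappa_g Rd eps0 * sigma.
Proof.
move=> tau2; apply: (le_trans (mean_multiplier k)).
have b0 := b_gt0; have e0 := eps0_gt0.
have l0 : 0 <= ln (32 * b ^+ 2 / eps0 ^+ 2).
  rewrite ln_ge0// ler_pdivlMr ?exprn_gt0// mul1r.
  have : eps0 ^+ 2 <= b ^+ 2 by rewrite ler_pXn2r ?nnegrE ?eps0_le_b// ltW.
  have := sqr_ge0 b; lra.
have k30 : 0 <= kappa3 p nu_g kappa_g Rd eps0.
  rewrite /kappa3 -/b addr_ge0//; first by lra.
  by rewrite mulr_ge0// divr_ge0 ?mulr_ge0 ?sqr_ge0// ltW.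
have := ler_wpM2r k30 tau2.
rewrite /kappabar /theta /D -/b.
rewrite (_ : t0%:R * (sigma * b) = tau * b); last by rewrite /tau; ring.
rewrite {1}/kappa3 -/b.
rewrite (_ : 8 * (tau * b ^+ 2) / eps0 * ln _ = tau * (8 * b ^+ 2 / eps0 * ln (32 * b ^+ 2 / eps0 ^+ 2))); last by ring.
lra.
Qed.

End Slater.


(** * Averaged iterates *)

Lemma xbar_in K w : (0 < K)%N -> C (xbar xs K w).
Proof. by move=> K0; apply: (convex_average (y := xs^~ w)) => // k; exact: traj_in. Qed.

Lemma bmfun_expect_xbar H K : (0 < K)%N -> bounded_field H ->
  bmfun (fun w => expect mu H (xbar xs K w)).
Proof.
move=> K0 bH; apply: bmfun_Rintegral; apply: (bmfun_field bH).
  by move=> w; exact: xbar_in.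
move=> j; rewrite /xbar; under eq_fun do rewrite mxE summxE.
apply: measurable_funM; first exact: measurable_cst.
apply: measurable_sum => k.
exact: (measurable_past iid (f := fun w => xs k w 0 j) ((traj_adapted k).1 j)).
Qed.

(** Jensen is applied to [H] at each fixed sample [z] and then integrated, after the samples along
    the trajectory are replaced by their means. *)
Lemma expect_xbar_le H K : (0 < K)%N -> bounded_field H ->
  (forall x z, C x -> exists s, is_subgrad C (fun y => H y z) x s) ->
  \int[P]_w expect mu H (xbar xs K w) <=
  (K%:R)^-1 * \int[P]_w (\sum_(k < K) H (xs k w) (xi k w)).
Proof.
move=> K0 bH sub.
have bk (k : 'I_K) : bmfun (fun w => expect mu H (xs k w)).
  exact: bmfun_past iid _ _ (bmfun_expect_traj k bH).
have bt (k : 'I_K) : bmfun (fun w => H (xs k w) (xi k w)).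
  exact: bmfun_past iid _ _ (bmfun_traj k bH).
rewrite Rint_sum//; under eq_bigr do rewrite expect_along_traj//.
rewrite -Rint_sum// -RintZ; last exact: bmfun_sum.
apply: Rint_le; first exact: bmfun_expect_xbar.
  by apply: bmfunZ; exact: bmfun_sum.
move=> w; have bx k := bmfun_field_at bH (traj_in k w).
rewrite -[X in _ * X](Rint_sum mu) // -RintZ; last exact: bmfun_sum.
apply: Rint_le; first exact: bmfun_field_at bH (xbar_in w K0).
  by apply: bmfunZ; exact: bmfun_sum.
move=> z; have [s hs] := sub _ z (xbar_in w K0).
exact: (subgrad_jensen K0 (fun k => traj_in k w) hs).
Qed.

Lemma bounded_field_F xstar : C xstar ->
  bounded_field (fun x z => F x z - F xstar z).
Proof.
move=> Cs; split.
  move=> d' T X Z' CX mX mZ; apply: measurable_funB; first exact: measF.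
  by apply: measF => // j; exact: measurable_cst.
have lip x y z : C x -> C y -> F x z - F y z <= kappa_f * Rd.
  move=> Cx Cy; have := subF z Cx Cy; have := dot_le_enorm (v0 x z) (x - y).
  rewrite -(opprB y x) dotNr enormN => h1 h2.
  have : enorm (v0 x z) * enorm (y - x) <= kappa_f * Rd.
    by apply: ler_pM; rewrite ?enorm_ge0 ?boundv0 ?diamC.
  lra.
exists (kappa_f * Rd) => x z Cx; rewrite ler_norml lip// andbT.
by have := lip xstar x z Cs Cx; lra.
Qed.

Lemma subgrad_shift_F xstar x z : C x ->
  exists s, is_subgrad C (fun y => F y z - F xstar z) x s.
Proof. by move=> Cx; exists (v0 x z) => y Cy; have := subF z Cx Cy; lra. Qed.

Lemma objective_sum xstar K w : C xstar ->
  (forall i : 'I_p, expect mu (fun x z => G x z 0 i) xstar <= 0) ->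
  \sum_(k < K) (F (xs k w) (xi k w) - F xstar (xi k w)) <=
  \sum_(k < K) noise xstar k w +
  (K%:R * (kappa_f ^+ 2 / (2 * alpha) + sigma / 2 * nu_g ^+ 2)
   + alpha / 2 * Rd ^+ 2).
Proof.
move=> Cs feas; have s0 := sigma_gt0; have a0 := alpha_gt0.
pose c := kappa_f ^+ 2 / (2 * alpha) + sigma / 2 * nu_g ^+ 2.
pose dist k := enorm (xstar - xs k w) ^+ 2.
(* The induction carries the telescoping terms exactly; those with a favourable sign are dropped
   afterwards. *)
have h : \sum_(k < K) (F (xs k w) (xi k w) - F xstar (xi k w)) <=
    \sum_(k < K) noise xstar k w + K%:R * c - Z K w ^+ 2 / (2 * sigma)
    + alpha / 2 * (dist 0%N - dist K).
  elim: K => [|K ih].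
    by rewrite !big_ord0 /Z enorm_lams0 expr0n/= subrr !mul0r !mulr0 subr0 !addr0.
  rewrite !big_ord_recr/=.
  have st := prox_objective_bound convC subF subG boundG boundv0 sigma_gt0 alpha_gt0
    (traj_in K w) (traj_in K.+1 w) (traj_min K w) (lamsS K w) Cs.
  have hn : dot (lams K w) (G xstar (xi K w)) <= noise xstar K w.
    rewrite dot_lams_noise gerDl; apply: sumr_le0 => i _.
    by rewrite mulr_ge0_le0 ?lams_ge0.
  have T1 : K.+1%:R = K%:R + 1 :> R by rewrite -natr1.
  rewrite T1; move: ih st hn; rewrite -/(dist K) -/(dist K.+1) -/(Z K w) -/(Z K.+1 w) -/c.
  rewrite mulrBl => ih st hn.
  move: (\sum_(k < K) _) (\sum_(k < K) _) ih => S1 S2 ih.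
  move: (Z K w ^+ 2 / _) (Z K.+1 w ^+ 2 / _) ih st => Z1 Z2 ih st.
  rewrite /c in ih st *; lra.
apply: (le_trans h).
have Rd0 : 0 <= Rd by rewrite (le_trans _ (diamC Cx0 Cx0))// enorm_ge0.
have hd : dist 0%N <= Rd ^+ 2.
  by rewrite /dist ler_pXn2r ?nnegrE ?enorm_ge0 ?diamC//; exact: traj_in.
have hK : 0 <= dist K by exact: sqr_ge0.
have hz : 0 <= Z K w ^+ 2 / (2 * sigma).
  by rewrite divr_ge0 ?sqr_ge0// mulr_ge0// ltW.
have := ler_wpM2l (divr_ge0 (ltW a0) (ler0n _ 2)) (_ : dist 0%N - dist K <= Rd ^+ 2).
rewrite -/c; lra.
Qed.

(** Telescoping [multiplier_increase], with step lengths bounded by [prox_step_bound]. The result is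
    linear in the norms [Z], so a bound on their means suffices. *)
Lemma constraint_sum i K w :
  \sum_(k < K) G (xs k w) (xi k w) 0 i <= Z K w / sigma +
  \sum_(k < K) kappa_g / alpha *
    (kappa_f + kappa_g * (Num.sqrt p%:R * (Z k w + sigma * nu_g))).
Proof.
have s0 := sigma_gt0; have a0 := alpha_gt0.
have kg0 : 0 <= kappa_g.
  by rewrite (le_trans _ (boundv i point Cx0))// enorm_ge0.
pose b k := kappa_g / alpha *
  (kappa_f + kappa_g * (Num.sqrt p%:R * (Z k w + sigma * nu_g))).
rewrite -/(\sum_(k < K) b k).
have h : sigma * \sum_(k < K) (G (xs k w) (xi k w) 0 i - b k) <= lams K w 0 i.
  elim: K => [|K ih]; first by rewrite big_ord0 mulr0 lams_ge0.
  rewrite big_ord_recr/= mulrDr.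
  have st := multiplier_increase boundv sigma_gt0 (traj_in K w) (lamsS K w) i.
  have hstep := prox_step_bound convC boundG boundv0 boundv sigma_gt0 alpha_gt0
    (traj_in K w) (traj_in K.+1 w) (traj_min K w).
  have : kappa_g * enorm (xs K.+1 w - xs K w) <= b K.
    rewrite /b -mulrA; apply: ler_wpM2l => //.
    by rewrite -(ler_pM2l a0) mulVKf// gt_eqF.
  rewrite -(ler_pM2l s0) => hb; rewrite mulrBr in st *; lra.
rewrite sumrB in h.
have hl : lams K w 0 i <= Z K w.
  by rewrite (le_trans (ler_norm _))// normr_coord_le.
have := le_trans h hl.
by rewrite -ler_pdivlMl// mulrC lerBlDr.
Qed.

Lemma constraint_mean i K M : (forall k, \int[P]_w Z k w <= M) ->
  \int[P]_w (\sum_(k < K) G (xs k w) (xi k w) 0 i) <= M / sigma +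
  K%:R * (kappa_g / alpha * (kappa_f + kappa_g * (Num.sqrt p%:R * (M + sigma * nu_g)))).
Proof.
move=> ZM; have bZ k : bmfun (Z k) by exact: bmfun_past iid _ _ (bmfun_enorm_lams k).
have kg0 : 0 <= kappa_g.
  by rewrite (le_trans _ (boundv i point Cx0))// enorm_ge0.
pose B2 := kappa_g / alpha * (kappa_g * Num.sqrt p%:R).
pose B1 := kappa_g / alpha * (kappa_f + kappa_g * (Num.sqrt p%:R * (sigma * nu_g))).
have B20 : 0 <= B2.
  by rewrite mulr_ge0 ?divr_ge0 ?mulr_ge0 ?sqrtr_ge0// ltW.
have bB (k : 'I_K) : bmfun (fun w => B1 + B2 * Z k w).
  by apply: bmfunD; [exact: bmfun_cst|exact: bmfunZ].
apply: (@le_trans _ _ (\int[P]_w (sigma^-1 * Z K w + \sum_(k < K) (B1 + B2 * Z k w)))).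
  apply: Rint_le.
  - by apply: bmfun_sum => k; exact: bmfun_past iid _ _ (bmfun_traj k (bounded_field_G i)).
  - by apply: bmfunD; [exact: bmfunZ|exact: bmfun_sum].
  - move=> w; apply: (le_trans (constraint_sum i K w)).
    rewrite mulrC lerD2l le_eqVlt; apply/orP; left; apply/eqP.
    by apply: eq_bigr => k _; rewrite /B1 /B2; ring.
rewrite RintD; [|exact: bmfunZ|exact: bmfun_sum].
rewrite RintZ// Rint_sum//; apply: lerD.
  by rewrite mulrC ler_pM2r ?invr_gt0.
apply: (@le_trans _ _ (\sum_(k < K) (B1 + B2 * M))).
  apply: ler_sum => k _; rewrite RintD; [|exact: bmfun_cst|exact: bmfunZ].
  by rewrite Rint_cst RintZ// lerD2l ler_wpM2l.
rewrite sumr_const card_ord -mulr_natl le_eqVlt; apply/orP; left; apply/eqP.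
by rewrite /B1 /B2; ring.
Qed.

Lemma objective_mean xstar K : C xstar ->
  (forall i : 'I_p, expect mu (fun x z => G x z 0 i) xstar <= 0) ->
  \int[P]_w (\sum_(k < K) (F (xs k w) (xi k w) - F xstar (xi k w))) <=
  K%:R * (kappa_f ^+ 2 / (2 * alpha) + sigma / 2 * nu_g ^+ 2) + alpha / 2 * Rd ^+ 2.
Proof.
move=> Cs feas.
have bn k : bmfun (noise xstar k) by exact: bmfun_past iid _ _ (bmfun_noise k Cs).
set c := _ + alpha / 2 * _.
have bc : bmfun (fun w => \sum_(k < K) noise xstar k w + c).
  by apply: bmfunD; [exact: bmfun_sum|exact: bmfun_cst].
apply: (@le_trans _ _ (\int[P]_w (\sum_(k < K) noise xstar k w + c))).
  apply: Rint_le => // [|w]; last exact: objective_sum.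
  apply: bmfun_sum => k.
  exact: bmfun_past iid _ _ (bmfun_traj k (bounded_field_F Cs)).
rewrite RintD; [|exact: bmfun_sum|exact: bmfun_cst].
rewrite Rint_cst Rint_sum// big1 ?add0r// => k _.
have /noise_centered := bmfun_cst (T := past xi k) (1 : R).
move=> /(_ _ Cs) h; rewrite -[RHS]h.
by under [RHS]eq_Rintegral do rewrite mul1r.
Qed.

End Trajectory.

(** * Choice of the window and the two rates *)

Unset Implicit Arguments. Set Strict Implicit. Set Printing Implicit Defensive.

Theorem theorem1 (R : realType) (n p : nat)
  (C : set 'rV[R]_n)
  (d : measure_display) (Xi : measurableType d) (mu : probability Xi R)
  (F : 'rV[R]_n -> Xi -> R) (G : 'rV[R]_n -> Xi -> 'rV[R]_p)
  (v0 : 'rV[R]_n -> Xi -> 'rV[R]_n) (v : 'I_p -> 'rV[R]_n -> Xi -> 'rV[R]_n)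
  (Rd nu_g kappa_f kappa_g eps0 : R) (xhat x0 : 'rV[R]_n)
  (dO : measure_display) (Omega : measurableType dO) (P : probability Omega R)
  (xi : nat -> Omega -> Xi)
  (xs : nat -> Omega -> 'rV[R]_n) (lams : nat -> Omega -> 'rV[R]_p)
  (K : nat) :
  (* C nonempty compact convex *)
  C !=set0 -> compact C -> convex_set C ->
  (* convexity and continuity of F(., z), G_i(., z) on C *)
  (forall z, convex_on C (fun x => F x z) /\ {within C, continuous (fun x => F x z)}) ->
  (forall z (i : 'I_p),
     convex_on C (fun x => G x z ord0 i) /\ {within C, continuous (fun x => G x z ord0 i)}) ->
  (* f, g_i finite on C *)
  (forall x, C x -> mu.-integrable setT (fun z => (F x z)%:E)) ->
  (forall x (i : 'I_p), C x -> mu.-integrable setT (fun z => (G x z ord0 i)%:E)) ->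
  (* stochastic subgradients *)
  (forall x z, C x -> is_subgrad C (fun y => F y z) x (v0 x z)) ->
  (forall (i : 'I_p) x z, C x -> is_subgrad C (fun y => G y z 0 i) x (v i x z)) ->
  (* (implicit) joint measurability of the data *)
  jmeasurable C F -> (forall i : 'I_p, jmeasurable C (fun x z => G x z ord0 i)) ->
  (forall j : 'I_n, jmeasurable C (fun x z => v0 x z ord0 j)) ->
  (forall (i : 'I_p) (j : 'I_n), jmeasurable C (fun x z => v i x z ord0 j)) ->
  (* (A1) *)
  (forall x y, C x -> C y -> enorm (x - y) <= Rd) ->
  (* (A2) *)
  (forall x z, C x -> enorm (G x z) <= nu_g) ->
  (* (A3) *)
  (forall x z, C x -> enorm (v0 x z) <= kappa_f) ->
  (forall (i : 'I_p) x z, C x -> enorm (v i x z) <= kappa_g) ->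
  (* (A4) Slater *)
  0 < eps0 -> C xhat ->
  (forall i : 'I_p, expect mu (fun x z => G x z ord0 i) xhat <= - eps0) ->
  (* SLPMM with alpha = sqrt K, sigma = 1/sqrt K, driven by i.i.d. samples *)
  iid_with_law P mu xi ->
  C x0 ->
  slpmm_traj ((Num.sqrt (K%:R))^-1) (Num.sqrt (K%:R)) C F G v0 v x0 xi xs lams ->
  (0 < K)%N ->
  (* (i) *)
  ((Num.max 1 (p%:R * kappa_g ^+ 2 / 2) < K%:R) ->
    forall i : 'I_p,
     ('E_P[fun w => expect mu (fun x z => G x z ord0 i) (xbar xs K w)] <=
       (((1 + Num.sqrt (p%:R) * kappa_g ^+ 2) * kappabar p kappa_f nu_g kappa_g Rd eps0
          + kappa_g * kappa_f) / Num.sqrt (K%:R)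
        + ((1 + Num.sqrt (p%:R) * kappa_g ^+ 2) * kappa2 p nu_g kappa_g Rd eps0
          + Num.sqrt (p%:R) * nu_g * kappa_g ^+ 2) / K%:R)%:E)%E)
  /\
  (* (ii) *)
  (forall xstar : 'rV[R]_n,
     C xstar -> (forall i : 'I_p, expect mu (fun x z => G x z ord0 i) xstar <= 0) ->
     (forall x, C x -> (forall i : 'I_p, expect mu (fun x z => G x z ord0 i) x <= 0) ->
        expect mu F xstar <= expect mu F x) ->
     ('E_P[fun w => expect mu F (xbar xs K w)] - (expect mu F xstar)%:E <=
       ((kappa_f ^+ 2 + nu_g ^+ 2 + Rd ^+ 2) / (2 * Num.sqrt (K%:R)))%:E)%E).
Proof.
move=> _ _ cC _ _ intF _ subF subG mF mG mv0 mv dC bG bv0 bv e0 Cxh slater iid Cx0 traj K0.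
have convC (x y : 'rV[R]_n) (t : R) : C x -> C y -> 0 <= t <= 1 -> C (t *: x + (1 - t) *: y).
  move=> Cx Cy /andP[t0 t1].
  have := cC x y (Itv01 t0 t1); rewrite !inE => /(_ Cx Cy).
  by [].
set sK := Num.sqrt K%:R in traj *.
have K1 : 0 < K%:R :> R by rewrite ltr0n.
have sK0 : 0 < sK by rewrite sqrtr_gt0.
have sKE : K%:R = sK ^+ 2 by rewrite sqr_sqrtr// ltW.
have sK1 : 1 <= sK.
  by rewrite -[1]sqrtr1 /sK ler_wsqrtr// ler1n.
have s0 : 0 < sK^-1 by rewrite invr_gt0.
split.
  move=> _ i.
  have bGi := bounded_field_G mG bG i.
  rewrite expectation_bmfun; last first.
    exact: (bmfun_expect_xbar convC mF mG mv0 mv iid Cx0 s0 sK0 traj K0 bGi).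
  rewrite lee_fin.
  (* An integer with [sqrt K <= t0 <= sqrt K + 1]: it dominates [alpha] and keeps [sigma * t0] at
     most 2. *)
  pose t0 := (Num.truncn sK).+1.
  have t0_ge : sK <= t0%:R by rewrite ltW// truncnS_gt.
  have tau2 : sK^-1 * t0%:R <= 2.
    rewrite mulrC ler_pdivrMr// /t0 -natr1.
    have : (Num.truncn sK)%:R <= sK by rewrite truncn_le ltW.
    lra.
  have meanZ k := mean_multiplier_kappabar convC subG mF mG mv0 mv dC bG bv0 bv iid Cx0
    s0 sK0 traj e0 Cxh slater i (ltn0Sn _ : (0 < t0)%N) t0_ge k tau2.
  have hc := constraint_mean convC mF mG mv0 mv dC bG bv0 bv iid Cx0 s0 sK0 traj i K meanZ.
  have hx := expect_xbar_le convC mF mG mv0 mv iid Cx0 s0 sK0 traj K0 bGi.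
  apply: (le_trans (hx _)).
    by move=> x z Cx; exists (v i x z); exact: subG.
  have K2 : 0 <= (K%:R : R)^-1 by rewrite invr_ge0 ltW.
  apply: (le_trans (ler_wpM2l K2 hc)).
  (* With [M = kappabar + kappa2 / sqrt K], dividing by [K] gives the stated bound exactly. *)
  rewrite sKE le_eqVlt; apply/orP; left; apply/eqP.
  move: sK0; clear; move: (kappabar _ _ _ _ _ _) (kappa2 _ _ _ _ _) (Num.sqrt p%:R) sK.
  by move=> kb k2 sp s s0; field; rewrite gt_eqF.
move=> xstar Cs feas _.
have bH := bounded_field_F subF mF dC bv0 Cs.
(* Subtracting [F xstar] yields a bounded field, and [expect mu F xstar] cancels in the final
   difference. *)
pose H x z := F x z - F xstar z.
have EF x : C x -> expect mu F x = expect mu H x + expect mu F xstar.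
  move=> Cx; rewrite /expect -[fine _]/(\int[mu]_z F x z) -[X in _ + X]/(\int[mu]_z F xstar z).
  rewrite -[X in X + _]/(\int[mu]_z (F x z - F xstar z)) RintegralB//; last 2 first.
  - exact: intF.
  - exact: intF.
  by rewrite subrK.
have bx := bmfun_expect_xbar convC mF mG mv0 mv iid Cx0 s0 sK0 traj K0 bH.
have -> : (fun w => expect mu F (xbar xs K w)) =
    (fun w => expect mu H (xbar xs K w) + expect mu F xstar).
  by apply/funext => w; apply: EF; exact: (xbar_in convC Cx0 traj _ K0).
rewrite expectation_bmfun; last by apply: bmfunD => //; exact: bmfun_cst.
rewrite RintD//; last exact: bmfun_cst.
rewrite Rint_cst -EFinB lee_fin addrK.
apply: (le_trans (expect_xbar_le convC mF mG mv0 mv iid Cx0 s0 sK0 traj K0 bH _)).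
  by move=> x z Cx; exact: (subgrad_shift_F subF).
have ho := objective_mean convC subF subG mF mG mv0 mv dC bG bv0 bv iid Cx0 s0 sK0 traj K Cs feas.
have K2 : 0 <= (K%:R : R)^-1 by rewrite invr_ge0 ltW.
apply: (le_trans (ler_wpM2l K2 ho)).
rewrite sKE le_eqVlt; apply/orP; left; apply/eqP.
by move: sK0; clear; move: sK => s s0; field; rewrite gt_eqF.
Qed.
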